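(* Let $k$ be a field. The Poincaré series of the line graph algebras $L_n$ and cycle graph algebras $C_n$ satisfy the recursion formulas $$P_{L_n}(t)=\frac{(1+t)P_{L_{n-1}}(t)P_{L_{n-2}}(t)}{(1+t)P_{L_{n-2}}(t)-tP_{L_{n-1}}(t)}\qquad (n\ge 2),$$ where $P_{L_0}(t)=1+t$ and $P_{L_1}(t)=(1+t)/(1-t)$, and $$P_{C_n}(t)=\frac{(1+t)P_{L_{n-2}}(t)P_{L_{n-4}}(t)}{P_{L_{n-2}}(t)+(1+t)P_{L_{n-4}}(t)}\qquad (n\ge 4).$$ Furthermore, for every integer $\alpha\ge 1$, $$P_{L_n^{2\alpha,\alpha}}(t)=(1+t)^{(n+1)(\alpha-1)}P_{L_n}(t)\qquad (n\ge 1)$$ and $$P_{C_n^{2\alpha,\alpha}}(t)=(1+t)^{n(\alpha-1)}P_{C_n}(t)\qquad (n\ge 3).$$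
   Context: For a graded $k$-algebra $R=k[x_1,\ldots,x_N]/I$ ($I$ a homogeneous ideal, standard grading), the Poincaré series is the formal power series $P_R(t)=\sum_{i\ge 0}\dim_k \mathrm{Tor}_i^R(k,k)\,t^i$. A hypergraph $H=(V,E)$ with $V=\{x_1,\ldots,x_N\}$ and $E\subseteq 2^V$ defines the hypergraph algebra $k[x_1,\ldots,x_N]/(\prod_{x\in e}x : e\in E)$. The same symbol is used for a hypergraph and its algebra. Line graph algebra: $L_n=k[x_1,\ldots,x_{n+1}]/(x_1x_2,x_2x_3,\ldots,x_nx_{n+1})$ for $n\ge 1$, and $L_0=k[x_1]$. Cycle graph algebra ($n\ge 3$): $C_n=k[x_1,\ldots,x_n]/(x_1x_2,x_2x_3,\ldots,x_{n-1}x_n,x_nx_1)$. Hyperline $L_n^{d,\alpha}$ ($\alpha\geq 1$): a hypergraph with $nd-(n-1)\alpha$ vertices and $n$ edges $e_1,\ldots,e_n$, all of size $d$, such that for $i\ne j$ one has $|e_i\cap e_j|=\alpha$ if $|i-j|=1$ and $e_i\cap e_j=\emptyset$ otherwise. Hypercycle $C_n^{d,\alpha}$ ($\alpha\geq 1$, $n\ge 3$): a hypergraph with $n(d-\alpha)$ vertices, each lying in some edge, and $n$ edges $e_1,\ldots,e_n$, all of size $d$, such that for $i\ne j$ one has $|e_i\cap e_j|=\alpha$ if $i-j\equiv\pm1\pmod n$ and $e_i\cap e_j=\emptyset$ otherwise.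
   Formalization: In the recursion for P_{C_n} the denominator is corrected to -t P_{L_{n-2}}(t) + (1+t) P_{L_{n-4}}(t); as printed, without the factor -t, the right-hand side has constant term 1/2 while P_{C_n} has constant term 1, so it fails for every n ≥ 4. *)

(* Defs.v *)
From HB Require Import structures.
From mathcomp Require Import all_boot all_order all_algebra ring_quotient.
From mathcomp Require Import boolp.
From mathcomp.multinomials Require Import mpoly.

Set Implicit Arguments.
Unset Strict Implicit.
Unset Printing Implicit Defensive.

Import GRing.Theory.
Local Open Scope ring_scope.
Local Open Scope quotient_scope.

Record fps (K : fieldType) := FPS { fps_coef :> nat -> K }.

Section PowerSeries.
Variable K : fieldType.
Implicit Types f g h : fps K.

Lemma fpsP f g : (forall n, f n = g n) -> f = g.
Proof. by case: f; case: g => g f /= fg; congr FPS; exact/funext. Qed.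

HB.instance Definition _ := gen_eqMixin (fps K).
HB.instance Definition _ := gen_choiceMixin (fps K).

Definition fps_zero : fps K := FPS (fun=> 0).
Definition fps_opp f : fps K := FPS (fun n => - f n).
Definition fps_add f g : fps K := FPS (fun n => f n + g n).

Lemma fps_addA : associative fps_add.
Proof. by move=> f g h; apply: fpsP => n /=; rewrite addrA. Qed.
Lemma fps_addC : commutative fps_add.
Proof. by move=> f g; apply: fpsP => n /=; rewrite addrC. Qed.
Lemma fps_add0 : left_id fps_zero fps_add.
Proof. by move=> f; apply: fpsP => n /=; rewrite add0r. Qed.
Lemma fps_addN : left_inverse fps_zero fps_opp fps_add.
Proof. by move=> f; apply: fpsP => n /=; rewrite addNr. Qed.

HB.instance Definition _ :=
  GRing.isZmodule.Build (fps K) fps_addA fps_addC fps_add0 fps_addN.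

Definition fps_one : fps K := FPS (fun n => (n == 0%N)%:R).
Definition fps_mul f g : fps K :=
  FPS (fun n => \sum_(i < n.+1) f i * g (n - i)%N).

Definition fps_trunc n f : {poly K} := \poly_(i < n) f i.

Lemma fps_mul_trunc n m f g :
  (m < n)%N -> fps_mul f g m = (fps_trunc n f * fps_trunc n g)`_m.
Proof.
move=> mn; rewrite coefM; apply: eq_bigr => i _.
rewrite !coef_poly (leq_ltn_trans _ mn) ?leq_ord //.
by rewrite (leq_ltn_trans _ mn) ?leq_subr.
Qed.

Lemma fps_mulA : associative fps_mul.
Proof.
move=> f g h; apply: fpsP => n.
transitivity (fps_trunc n.+1 f * fps_trunc n.+1 g * fps_trunc n.+1 h)`_n.
  rewrite -mulrA coefM; apply: eq_bigr => i _.
  by rewrite coef_poly ltn_ord (@fps_mul_trunc n.+1) // ltnS leq_subr.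
rewrite coefM; apply: eq_bigr => i _.
by rewrite coef_poly ltnS leq_subr (@fps_mul_trunc n.+1).
Qed.

Lemma fps_mulC : commutative fps_mul.
Proof.
by move=> f g; apply: fpsP => n; rewrite !(@fps_mul_trunc n.+1) // mulrC.
Qed.

Lemma fps_mul1 : left_id fps_one fps_mul.
Proof.
move=> f; apply: fpsP => n /=.
rewrite big_ord_recl /= mul1r subn0 big1 ?addr0 // => i _.
by rewrite mul0r.
Qed.

Lemma fps_mulDl : left_distributive fps_mul +%R.
Proof.
move=> f g h; apply: fpsP => n /=.
by rewrite -big_split; apply: eq_bigr => i _; rewrite mulrDl.
Qed.

Lemma fps_one_neq0 : fps_one != 0.
Proof. by apply/eqP => /(congr1 (fun f => f 0%N)) /eqP; rewrite oner_eq0. Qed.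

HB.instance Definition _ := GRing.Zmodule_isComNzRing.Build (fps K)
  fps_mulA fps_mulC fps_mul1 fps_mulDl fps_one_neq0.

Lemma fps_coef0 n : (0 : fps K) n = 0. Proof. by []. Qed.
Lemma fps_coef1 n : (1 : fps K) n = (n == 0%N)%:R. Proof. by []. Qed.
Lemma fps_coefN f n : (- f) n = - f n. Proof. by []. Qed.
Lemma fps_coefD f g n : (f + g) n = f n + g n. Proof. by []. Qed.
Lemma fps_coefB f g n : (f - g) n = f n - g n. Proof. by []. Qed.
Lemma fps_coefM f g n : (f * g) n = \sum_(i < n.+1) f i * g (n - i)%N.
Proof. by []. Qed.
Lemma fps_coefM0 f g : (f * g) 0%N = f 0%N * g 0%N.
Proof. by rewrite fps_coefM big_ord1 subn0. Qed.

Lemma fps_coef_sum n (F : nat -> fps K) m :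
  (\sum_(j < n) F j) m = \sum_(j < n) F j m.
Proof. by elim: n => [|n IH]; rewrite ?big_ord0 // !big_ord_recr -IH. Qed.

Definition fpsC (c : K) : fps K := FPS (fun n => if n == 0%N then c else 0).
Definition fpsX : fps K := FPS (fun n => (n == 1%N)%:R).

Lemma fps_coefCM c f n : (fpsC c * f) n = c * f n.
Proof.
rewrite fps_coefM big_ord_recl /= subn0 big1 ?addr0 // => i _.
by rewrite mul0r.
Qed.

Lemma fps_coefX_lt (u : fps K) m n : u 0%N = 0 -> (n < m)%N -> (u ^+ m) n = 0.
Proof.
move=> u0; elim: m n => // m IH n nm.
rewrite exprS fps_coefM big1 // => [[[|i] /= in1]] _; first by rewrite u0 mul0r.
rewrite IH ?mulr0 //; apply: (@leq_trans n) => //.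
by rewrite ltn_subrL /=; apply: leq_ltn_trans (in1 : (i < n)%N).
Qed.

(** Geometric series: f^-1 = c * (1 + u + u^2 + ...), where c is the inverse
    of the constant term of f and u = 1 - c * f has constant term 0.         *)
Definition fps_unit : pred (fps K) := fun f => f 0%N != 0.
Definition fps_inv f : fps K :=
  if f 0%N == 0 then f else
  FPS (fun n => (f 0%N)^-1 *
                \sum_(j < n.+1) ((1 - fpsC (f 0%N)^-1 * f) ^+ j) n).

Lemma fps_mulVf : {in fps_unit, left_inverse 1 fps_inv *%R}.
Proof.
move=> f f0; rewrite unfold_in in f0; rewrite mulrC; apply: fpsP => n.
rewrite /fps_inv (negPf f0); set c := (f 0%N)^-1; set u := 1 - _.
have u0 : u 0%N = 0 by rewrite /u fps_coefB fps_coefCM mulVf // subrr.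
pose g : fps K := \sum_(j < n.+1) u ^+ j.
transitivity ((f * (fpsC c * g)) n).
  rewrite !fps_coefM; apply: eq_bigr => i _; congr (_ * _).
  rewrite fps_coefCM [LHS]/=; congr (_ * _).
  rewrite (@fps_coef_sum n.+1 (fun j => u ^+ j)).
  rewrite -!(big_mkord xpredT (fun j => (u ^+ j) (n - i)%N)).
  have le_in : ((n - i).+1 <= n.+1)%N by rewrite ltnS leq_subr.
  rewrite [RHS](big_cat_nat _ le_in) //=.
  rewrite [X in _ = _ + X]big_nat_cond [X in _ = _ + X]big1 ?addr0 //.
  by move=> j /andP[/andP[ij _] _]; rewrite fps_coefX_lt.
have -> : f * (fpsC c * g) = 1 - u ^+ n.+1.
  rewrite mulrA (mulrC f) -[RHS](opprK) opprB subrX1 -mulNr opprB.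
  by congr (_ * _); rewrite /u opprB addrC subrK.
by rewrite fps_coefB fps_coefX_lt ?subr0.
Qed.

Lemma fps_unitP f g : g * f = 1 -> fps_unit f.
Proof.
move=> /(congr1 (fun f => f 0%N)); rewrite fps_coefM0 fps_coef1 /= => gf.
by apply/eqP => f0; move: gf; rewrite f0 mulr0 => /esym/eqP; rewrite oner_eq0.
Qed.

Lemma fps_inv_out : {in [predC fps_unit], fps_inv =1 id}.
Proof. by move=> f; rewrite inE /= unfold_in negbK /fps_inv => ->. Qed.

HB.instance Definition _ := GRing.ComNzRing_hasMulInverse.Build (fps K)
  fps_mulVf fps_unitP fps_inv_out.

End PowerSeries.

Arguments fpsX {K}.

(** k is an R-module through eps, which is meant to be onto; vectors are rows,
    so a matrix M acts by v |-> v *m M.  A resolution is an exact sequence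
      ... -> R^(rk 2) -> R^(rk 1) -> R^(rk 0) -> k -> 0
    where an R-linear map R^m -> k is v |-> (map_mx eps v) *m c for a unique
    column c over k, and is onto if and only if c != 0. *)
Record free_resolution (R : comNzRingType) (k : fieldType)
    (eps : {rmorphism R -> k}) := FreeResolution {
  res_rk : nat -> nat;
  res_d : forall i, 'M[R]_(res_rk i.+1, res_rk i);
  res_aug : 'cV[k]_(res_rk 0);
  res_aug_onto : res_aug != 0;
  res_exact0 : forall v : 'rV[R]_(res_rk 0),
    map_mx eps v *m res_aug = 0 <-> exists w, v = w *m res_d 0;
  res_exact : forall i (v : 'rV[R]_(res_rk i.+1)),
    v *m res_d i = 0 <-> exists w, v = w *m res_d i.+1
}.

Section Tor.
Variables (R : comNzRingType) (k : fieldType) (eps : {rmorphism R -> k}).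

Definition res_tensor_d (F : free_resolution eps) i :
    'M[k]_(res_rk F i.+1, res_rk F i) := map_mx eps (res_d F i).

(** dim ker - dim im in degree i of F \otimes_R k; in degree 0 the kernel is
    everything. *)
Definition res_homology_dim (F : free_resolution eps) (i : nat) : nat :=
  ((if i is j.+1 then \rank (kermx (res_tensor_d F j)) else res_rk F 0)
   - \rank (res_tensor_d F i))%N.

(** dim_k Tor_i^R(k, k), computed from an arbitrary resolution of k by free
    modules of finite rank (these exist when R is Noetherian, and the dimension
    does not depend on the one used; the value is 0 if there is none). *)
Definition tor_dim (i : nat) : nat :=
  if pselect (exists d, exists F : free_resolution eps,
                d = res_homology_dim F i) is left ex
  then sval (cid ex) else 0%N.

Definition poincare_of : fps rat := FPS (fun i => (tor_dim i)%:R).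

End Tor.

(** The empty set is not allowed as an edge: it would contribute the empty
    product 1 to the ideal and the algebra would be 0. *)
Record hypergraph (N : nat) := Hypergraph {
  edges :> {set {set 'I_N}};
  edges_neq0 : set0 \notin edges
}.

Section HypergraphAlgebra.
Variables (k : fieldType) (N : nat) (H : hypergraph N).

Definition edge_monomial (e : {set 'I_N}) : {mpoly k[N]} := \prod_(i in e) 'X_i.

Definition edge_ideal : {pred {mpoly k[N]}} := fun p =>
  `[< exists c : {set 'I_N} -> {mpoly k[N]},
        p = \sum_(e in edges H) c e * edge_monomial e >].

Lemma edge_idealP p :
  reflect (exists c : {set 'I_N} -> {mpoly k[N]},
             p = \sum_(e in edges H) c e * edge_monomial e)
          (p \in edge_ideal).
Proof. exact: asboolP. Qed.

Lemma edge_ideal_eval0 p : p \in edge_ideal -> p.@[fun=> 0] = 0.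
Proof.
case/edge_idealP => c ->; rewrite rmorph_sum /= big1 // => e eH.
rewrite mevalM rmorph_prod /=.
have /set0Pn[i ie] : e != set0.
  by apply: contraNneq (edges_neq0 H) => <-.
by rewrite (bigD1 i) //= mevalXU mul0r mulr0.
Qed.

Lemma edge_ideal_closed : idealr_closed edge_ideal.
Proof.
split.
- apply/edge_idealP; exists (fun=> 0).
  by rewrite big1 // => e _; rewrite mul0r.
- apply/negP => /edge_ideal_eval0; rewrite meval1 => /eqP.
  by rewrite oner_eq0.
- move=> a p q /edge_idealP[c ->] /edge_idealP[d ->]; apply/edge_idealP.
  exists (fun e => a * c e + d e).
  rewrite mulr_sumr -big_split; apply: eq_bigr => e _ /=.
  by rewrite mulrDl mulrA.
Qed.

HB.instance Definition _ := isIdealr.Build {mpoly k[N]} edge_ideal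
  edge_ideal_closed.

Definition hypergraph_algebra : comNzRingType := {ideal_quot edge_ideal}.

Definition hg_aug (r : hypergraph_algebra) : k := (repr r).@[fun=> 0].

Lemma hg_aug_pi p : hg_aug (\pi p) = p.@[fun=> 0].
Proof.
apply/eqP; rewrite -subr_eq0 -mevalB; apply/eqP/edge_ideal_eval0.
by rewrite Quotient.idealrBE reprK.
Qed.

Lemma hg_aug_zmod : zmod_morphism hg_aug.
Proof.
elim/quotW=> p; elim/quotW=> q.
by rewrite -rmorphB !hg_aug_pi mevalB.
Qed.

Lemma hg_aug_monoid : monoid_morphism hg_aug.
Proof.
split; first by rewrite -(rmorph1 \pi_hypergraph_algebra) hg_aug_pi meval1.
elim/quotW=> p; elim/quotW=> q.
by rewrite -rmorphM !hg_aug_pi mevalM.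
Qed.

HB.instance Definition _ :=
  GRing.isZmodMorphism.Build hypergraph_algebra k hg_aug hg_aug_zmod.
HB.instance Definition _ :=
  GRing.isMonoidMorphism.Build hypergraph_algebra k hg_aug hg_aug_monoid.

Definition poincare : fps rat := poincare_of hg_aug.

End HypergraphAlgebra.

Lemma line_edges_neq0 n :
  set0 \notin ([set [set inord i; inord i.+1] | i : 'I_n] : {set {set 'I_n.+1}}).
Proof.
by apply/imsetP => -[i _ /setP/(_ (inord i))]; rewrite !inE eqxx.
Qed.

Definition line_graph n : hypergraph n.+1 := Hypergraph (line_edges_neq0 n).

Lemma cycle_edges_neq0 n :
  set0 \notin ([set [set i; ordS i] | i : 'I_n] : {set {set 'I_n}}).
Proof. by apply/imsetP => -[i _ /setP/(_ i)]; rewrite !inE eqxx. Qed.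

(** Meant for [3 <= n]. *)
Definition cycle_graph n : hypergraph n := Hypergraph (cycle_edges_neq0 n).

Definition is_hyperline (n d a N : nat) (H : hypergraph N) : Prop :=
  N = (n * d - n.-1 * a)%N /\
  exists e : 'I_n -> {set 'I_N},
    [/\ injective e,
        edges H = [set e i | i : 'I_n],
        forall i, #|e i| = d &
        forall i j, i != j ->
          #|e i :&: e j| = if (j == i.+1 :> nat) || (i == j.+1 :> nat)
                           then a else 0%N].

Definition is_hypercycle (n d a N : nat) (H : hypergraph N) : Prop :=
  N = (n * (d - a))%N /\
  exists e : 'I_n -> {set 'I_N},
    [/\ injective e,
        edges H = [set e i | i : 'I_n],
        forall v, exists i, v \in e i,
        forall i, #|e i| = d &
        forall i j, i != j ->
          #|e i :&: e j| = if (j == ordS i) || (i == ordS j) then a else 0%N].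

(* Main.v *)
From HB Require Import structures.
Require Import Defs.
From mathcomp Require Import all_boot all_order all_algebra ring_quotient.
From mathcomp Require Import boolp zify ring.
From mathcomp.multinomials Require Import mpoly.

Set Implicit Arguments.
Unset Strict Implicit.
Unset Printing Implicit Defensive.

Import GRing.Theory Num.Theory.
Local Open Scope ring_scope.

(** Why the formulas hold. Write P_R for the Poincare series of the residue field
    over an augmented ring R. Three changes of rings control it.

    (a) Regular elements (poincare_regular_element). If f is a regular element of
    B that is not in the square of the augmentation ideal, then
    P_B = (1 + t) P_(B/f). Lift a resolution of k over B/f to matrices dt over B;
    then dt dt = f s for some matrices s, and two copies of the lift, glued by f
    and s, resolve k over B. A derivation B -> k with value 1 at f turns
    dt dt = f s into a null homotopy of s modulo the augmentation ideal, so that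
    Tor over B consists of two copies of Tor over B/f.

    (b) Retracts (poincare_retract). If R -> S has a section which is a ring
    homomorphism, take a resolution F of k over S and a resolution G of S over R.
    The section makes F (x) G a complex over R. It resolves k over R, and the
    Kunneth formula yields P_R = P_S * P^R_S, where P^R_S is the series of
    Tor^R(S, k).

    (c) Deletion (poincare_deletion). Let S = R/(x) and Q = R/(0 : x) both be
    retracts of R. As xR is isomorphic to Q, one has P^R_S = 1 + t P^R_Q, and
    eliminating P^R_Q from the two formulas (b) for S and Q leaves
    P_R (P_Q - t P_S) = P_S P_Q.

    The resolutions exist because all rings in question are Noetherian, and the
    homology does not depend on them (hdim_resolution).

    Graphs. For the variable x of a vertex v, the ring S belongs to the graph
    without v, and in Q the neighbours of v become zero and v becomes isolated;
    by (a) the isolated vertex contributes the factor 1 + t. This is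
    poincare_graph_deletion. Applied to an end of a line, or to any vertex of a
    cycle, it leaves only lines, and gives the two recursion formulas.

    Blocks. Counting incidences shows that a hyperline or hypercycle with edges of
    size 2a and intersections of size a is a line or cycle graph each of whose
    vertices has been replaced by a block of a vertices (hyperline_blocks,
    hypercycle_blocks). If v and w are in the same block, let B be the algebra
    in which the product vw is replaced by a new variable y. Both B/(y - vw),
    which is the given algebra, and B/(v), in which y plays the role of v and w
    is free, satisfy (a). So w may be freed without changing the series, and
    removed at the cost of a factor 1 + t (poincare_blowup). *)

(** * Homology of complexes of vector spaces *)

Section FieldComplexes.
Variable k : fieldType.

Definition cycle_space (f : nat -> nat) (D : forall i, 'M[k]_(f i.+1, f i)) i :
    'M[k]_(f i) :=
  match i with 0%N => 1%:M | j.+1 => kermx (D j) end.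

Definition hdim (f : nat -> nat) (D : forall i, 'M[k]_(f i.+1, f i)) i : nat :=
  (\rank (cycle_space D i) - \rank (D i))%N.

Section OneComplex.
Variables (f : nat -> nat) (D : forall i, 'M[k]_(f i.+1, f i)).
Hypothesis DD : forall i, D i.+1 *m D i = 0.

Lemma boundary_cycle i : (D i <= cycle_space D i)%MS.
Proof. by case: i => [|i]; rewrite ?submx1 //; apply/sub_kermxP. Qed.

(** Rows of P that represent a basis of the homology in degree i, and columns of
    Q that read off the coordinates of a class, determine its dimension. *)
Lemma hdim_unique i h (P : 'M_(h, f i)) (Q : 'M_(f i, h)) :
    (P <= cycle_space D i)%MS -> D i *m Q = 0 -> P *m Q = 1%:M ->
    (forall v : 'rV_(f i), (v <= cycle_space D i)%MS -> v *m Q = 0 ->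
       (v <= D i)%MS) ->
  hdim D i = h.
Proof.
move=> Pcyc DQ PQ exactQ; rewrite /hdim.
have -> : \rank (cycle_space D i) = \rank (P + D i)%MS.
  apply: eqmx_rank; apply/andP; split; last first.
    by rewrite addsmx_sub Pcyc boundary_cycle.
  apply/row_subP => j; set v := row j _.
  have vcyc : (v <= cycle_space D i)%MS by rewrite row_sub.
  have -> : v = v *m Q *m P + (v - v *m Q *m P) by rewrite addrC subrK.
  apply: addmx_sub_adds; first by rewrite submxMl.
  apply: exactQ.
    by rewrite addmx_sub // -mulNmx (submx_trans (submxMl _ _)).
  by rewrite mulmxBl -!mulmxA PQ mulmx1 subrr.
have dxPD : (P :&: D i)%MS = 0.
  apply/eqP; rewrite -submx0; apply/rV_subP => v; rewrite sub_capmx.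
  case/andP => /submxP[w ->] /submxP[u wP].
  suff -> : w = 0 by rewrite mul0mx sub0mx.
  by rewrite -[w]mulmx1 -PQ mulmxA wP -mulmxA DQ mulmx0.
rewrite mxrank_disjoint_sum // addnK.
by apply/eqP; rewrite -/(row_free P); apply/row_freeP; exists Q.
Qed.

(** Over a field the generalized inverses of the differentials form a homotopy s
    that retracts the complex onto its homology; P and Q are representatives and
    coordinates of the homology classes. *)
Lemma complex_splitting : exists (h : nat -> nat)
    (P : forall i, 'M[k]_(h i, f i)) (Q : forall i, 'M[k]_(f i, h i))
    (s : forall i, 'M[k]_(f i, f i.+1)),
  [/\ forall i, hdim D i = h i,
      forall i, P i.+1 *m D i = 0,
      forall i, D i *m Q i = 0,
      forall i, P i *m Q i = 1%:M &
      Q 0%N *m P 0%N = 1%:M - s 0%N *m D 0%N /\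
      forall i, Q i.+1 *m P i.+1 = 1%:M - s i.+1 *m D i.+1 - D i *m s i].
Proof.
pose g i := pinvmx (D i).
have DgD i : D i *m g i *m D i = D i by exact: mulmxKpV.
pose K i : 'M_(f i) := match i with 0%N => 0 | j.+1 => D j *m g j end.
have DK i : D i *m K i = 0 by case: i => [|i]; rewrite /= ?mulmx0 // mulmxA DD mul0mx.
(* correcting the generalized inverse by K makes the two projections onto
   boundaries and onto a complement of the cycles orthogonal *)
pose s i := (1%:M - K i) *m g i.
have Dsg i : D i *m s i = D i *m g i by rewrite mulmxA mulmxBr mulmx1 DK subr0.
pose E i := s i *m D i.
pose Pi i : 'M_(f i) := 1%:M - E i - K i.
have KK i : K i *m K i = K i.
  by case: i => [|i]; rewrite /= ?mulmx0 // mulmxA DgD.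
have DE i : D i *m E i = D i by rewrite mulmxA Dsg DgD.
have KE i : K i *m E i = 0.
  by rewrite /E /s !mulmxA mulmxBr mulmx1 KK subrr !mul0mx.
have EK i : E i *m K i = 0 by rewrite -mulmxA DK mulmx0.
have EE i : E i *m E i = E i by rewrite {1}/E -mulmxA DE.
have PiE i : Pi i *m E i = 0.
  by rewrite !mulmxBl mul1mx EE KE subrr subr0.
have PiK i : Pi i *m K i = 0.
  by rewrite !mulmxBl mul1mx EK KK subr0 subrr.
have PiPi i : Pi i *m Pi i = Pi i.
  by rewrite {2}/Pi !mulmxBr mulmx1 PiE PiK !subr0.
have DPi i : D i *m Pi i = 0 by rewrite !mulmxBr mulmx1 DE DK subrr subr0.
have PiD i : Pi i.+1 *m D i = 0.
  by rewrite !mulmxBl mul1mx DgD -mulmxA DD mulmx0 subr0 subrr.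
pose P i := row_base (Pi i); pose Q i := col_base (Pi i).
have QP i : Q i *m P i = Pi i by exact: mulmx_base.
have Qinj i m (X Y : 'M_(_, m)) : Q i *m X = Q i *m Y -> X = Y.
  by move=> eXY; apply: (row_full_inj _ eXY); exact: col_base_full.
have Pinj i m (X Y : 'M_(m, _)) : X *m P i = Y *m P i -> X = Y.
  by apply: row_free_inj; rewrite /P row_base_free.
have PQ i : P i *m Q i = 1%:M.
  apply: (@Qinj i); apply: (@Pinj i).
  by rewrite mulmx1 mulmxA -mulmxA QP PiPi.
have PD i : P i.+1 *m D i = 0 by apply: (@Qinj i.+1); rewrite mulmx0 mulmxA QP.
have DQ i : D i *m Q i = 0 by apply: (@Pinj i); rewrite mul0mx -mulmxA QP.
exists (fun i => \rank (Pi i)), P, Q, s; split=> //; last first.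
  by split=> [|i]; rewrite QP /Pi /= ?subr0 // Dsg.
move=> i; apply: (@hdim_unique i _ (P i) (Q i)) => //.
  by case: i => [|i]; rewrite ?submx1 //; apply/sub_kermxP.
move=> v vcyc vQ; have : v *m Pi i = 0 by rewrite -QP mulmxA vQ mul0mx.
have vK : v *m K i = v *m K i by [].
rewrite !mulmxBr mulmx1 mulmxA => /eqP; rewrite subr_eq0 subr_eq addrC => /eqP ->.
rewrite addmx_sub ?submxMl //.
case: i v vcyc {vQ vK} => [|i] v; first by rewrite mulmx0 sub0mx.
by move=> /sub_kermxP vD; rewrite /= mulmxA vD mul0mx sub0mx.
Qed.

End OneComplex.

Lemma hdim_diff (f : nat -> nat) (D : forall i, 'M[k]_(f i.+1, f i)) i :
  hdim D i = (f i - (if i is j.+1 then \rank (D j) else 0) - \rank (D i))%N.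
Proof. by case: i => [|i]; rewrite /hdim /= ?mxrank1 ?subn0 // mxrank_ker. Qed.

End FieldComplexes.

(** * Free resolutions *)

Lemma dependent_choice (T : nat -> Type) (G : forall i, T i -> Prop)
    (Rel : forall i, T i -> T i.+1 -> Prop) :
    (exists x, G 0%N x) ->
    (forall i x, G i x -> exists y, Rel i x y /\ G i.+1 y) ->
  exists x : forall i, T i, G 0%N (x 0%N) /\ forall i, Rel i (x i) (x i.+1).
Proof.
move=> /cid[x0 Gx0] step.
pose next i (x : {x | G i x}) : {y | Rel i (sval x) y /\ G i.+1 y} :=
  cid (step i (sval x) (svalP x)).
pose x := fix x i : {x | G i x} :=
  match i with
  | 0%N => exist _ x0 Gx0
  | j.+1 => exist _ (sval (next j (x j))) (svalP (next j (x j))).2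
  end.
by exists (fun i => sval (x i)); split=> // i; exact: (svalP (next i (x i))).1.
Qed.

Section MatrixLifting.
Variable R : comNzRingType.

Lemma mulmx_lift m n p (A : 'M[R]_(m, n)) (D : 'M_(p, n)) :
  (forall i, exists w, row i A = w *m D) -> exists W, A = W *m D.
Proof.
move=> /fin_all_exists[w wP]; exists (\matrix_i w i).
by apply/row_matrixP => i; rewrite row_mul rowK.
Qed.

Lemma map_mx_lift (S : nzRingType) (pi : R -> S) :
    (forall y, exists x, pi x = y) ->
  forall m n (A : 'M[S]_(m, n)), exists B, map_mx pi B = A.
Proof.
move=> onto m n A.
exists (\matrix_(i, j) sval (cid (onto (A i j)))).
by apply/matrixP => i j; rewrite !mxE; case: cid.
Qed.

End MatrixLifting.

(** The ring S is seen as a module over R through pi; the augmentation of the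
    resolution is v |-> pi v *m c. For a field S this is the notion underlying
    the definition of Tor; the general case serves for quotient rings of R. *)
Definition is_resolution (R S : comNzRingType) (pi : {rmorphism R -> S})
    (f : nat -> nat) (d : forall i, 'M[R]_(f i.+1, f i)) (c : 'cV[S]_(f 0%N)) :=
  [/\ exists v : 'rV_(f 0%N), map_mx pi v *m c = 1%:M,
      forall v : 'rV_(f 0%N), map_mx pi v *m c = 0 <-> exists w, v = w *m d 0%N &
      forall i (v : 'rV_(f i.+1)),
        v *m d i = 0 <-> exists w, v = w *m d i.+1].

Section Resolutions.
Variables (R S : comNzRingType) (pi : {rmorphism R -> S}).
Hypothesis pi_onto : forall y, exists x, pi x = y.

Section OneResolution.
Variables (f : nat -> nat) (d : forall i, 'M[R]_(f i.+1, f i)) (c : 'cV[S]_(f 0%N)).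
Hypothesis res : is_resolution pi d c.

Lemma res_complex i : d i.+1 *m d i = 0.
Proof.
case: res => _ _ ex; apply/row_matrixP => j; rewrite row_mul row0.
by apply/ex; exists (delta_mx 0 j); rewrite rowE.
Qed.

Lemma res_complex_aug : map_mx pi (d 0%N) *m c = 0.
Proof.
case: res => _ ex _; apply/row_matrixP => j; rewrite row_mul row0 -map_row.
by apply/ex; exists (delta_mx 0 j); rewrite rowE.
Qed.

Lemma res_exact_mx i m (A : 'M_(m, f i.+1)) :
  A *m d i = 0 -> exists W, A = W *m d i.+1.
Proof.
case: res => _ _ ex Ad; apply: mulmx_lift => j; apply/ex.
by rewrite -row_mul Ad row0.
Qed.

Lemma res_exact_aug_mx m (A : 'M_(m, f 0%N)) :
  map_mx pi A *m c = 0 -> exists W, A = W *m d 0%N.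
Proof.
case: res => _ ex _ Ac; apply: mulmx_lift => j; apply/ex.
by rewrite map_row -row_mul Ac row0.
Qed.

Lemma res_aug_lift_mx m (b : 'cV[S]_m) :
  exists A : 'M_(m, f 0%N), map_mx pi A *m c = b.
Proof.
case: res => -[u uc] _ _; case: (map_mx_lift pi_onto b) => B Bb.
by exists (B *m u); rewrite map_mxM -mulmxA uc Bb mulmx1.
Qed.

End OneResolution.

Lemma chain_map_exists (f g : nat -> nat) (d : forall i, 'M[R]_(f i.+1, f i))
    (e : forall i, 'M[R]_(g i.+1, g i)) (c : 'cV[S]_(f 0%N)) (b : 'cV[S]_(g 0%N)) :
    is_resolution pi d c -> is_resolution pi e b ->
  exists phi : forall i, 'M[R]_(f i, g i),
    map_mx pi (phi 0%N) *m b = c /\ forall i, d i *m phi i = phi i.+1 *m e i.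
Proof.
move=> dres eres; have [phi0 phi0P] := res_aug_lift_mx eres c.
have [||phi [phiP phiC]] := @dependent_choice (fun i => 'M[R]_(f i, g i))
  (fun i => match i with
     | 0%N => fun x => x = phi0
     | j.+1 => fun x => exists y, d j *m y = x *m e j end)
  (fun i x y => d i *m x = y *m e i).
- by exists phi0.
- case=> [_ ->|i x [y dy]].
    have [|z zP] := res_exact_aug_mx eres (A := d 0%N *m phi0).
      by rewrite map_mxM -mulmxA phi0P (res_complex_aug dres).
    by exists z; split=> //; exists phi0.
  have [|z zP] := res_exact_mx eres (A := d i.+1 *m x).
    by rewrite -mulmxA -dy mulmxA (res_complex dres) mul0mx.
  by exists z; split=> //; exists x.
by exists phi; split=> //; rewrite phiP.
Qed.

Lemma chain_homotopy_exists (f : nat -> nat) (d : forall i, 'M[R]_(f i.+1, f i))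
    (c : 'cV[S]_(f 0%N)) (psi : forall i, 'M[R]_(f i)) :
    is_resolution pi d c -> map_mx pi (psi 0%N) *m c = c ->
    (forall i, d i *m psi i = psi i.+1 *m d i) ->
  exists s : forall i, 'M[R]_(f i, f i.+1),
    1%:M - psi 0%N = s 0%N *m d 0%N /\
    forall i, 1%:M - psi i.+1 = s i.+1 *m d i.+1 + d i *m s i.
Proof.
move=> dres psic psid.
have [|s0 s0P] := res_exact_aug_mx dres (A := 1%:M - psi 0%N).
  by rewrite map_mxB mulmxBl map_mx1 mul1mx psic subrr.
have [||s [sP sC]] := @dependent_choice (fun i => 'M[R]_(f i, f i.+1))
  (fun i x => d i *m (1%:M - psi i - x *m d i) = 0 /\
     match i return 'M[R]_(f i, f i.+1) -> Prop with
     | 0%N => fun x => x = s0 | _.+1 => fun=> True end x)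
  (fun i x y => 1%:M - psi i.+1 = y *m d i.+1 + d i *m x).
- by exists s0; split=> //; rewrite s0P subrr mulmx0.
- move=> i x [xP _].
  have [|y yP] := res_exact_mx dres (A := 1%:M - psi i.+1 - d i *m x).
    move: xP; rewrite !mulmxBr !mulmxBl mulmx1 mul1mx psid !mulmxA.
    by rewrite -[d i *m x *m d i]mulmxA.
  exists y; split; first by rewrite -yP subrK.
  split=> //; rewrite -yP opprB addrCA subrr addr0 mulmxA.
  by rewrite (res_complex dres) mul0mx.
by exists s; split=> //; case: sP => _ ->.
Qed.

End Resolutions.

(** The homology of D embeds into that of E as soon as chi undoes phi up to
    homotopy. In terms of ranks: the cycles of D are images under chi of cycles
    of E up to boundaries, and chi maps boundaries to boundaries. *)
Lemma hdim_le (k : fieldType) (f g : nat -> nat)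
    (D : forall i, 'M[k]_(f i.+1, f i)) (E : forall i, 'M[k]_(g i.+1, g i))
    (phi : forall i, 'M_(f i, g i)) (chi : forall i, 'M_(g i, f i))
    (s : forall i, 'M_(f i, f i.+1)) :
    (forall i, D i.+1 *m D i = 0) -> (forall i, E i.+1 *m E i = 0) ->
    (forall i, D i *m phi i = phi i.+1 *m E i) ->
    (forall i, E i *m chi i = chi i.+1 *m D i) ->
    1%:M - phi 0%N *m chi 0%N = s 0%N *m D 0%N ->
    (forall i, 1%:M - phi i.+1 *m chi i.+1 = s i.+1 *m D i.+1 + D i *m s i) ->
  forall i, (hdim D i <= hdim E i)%N.
Proof.
move=> DD EE phiC chiC s0 sS i.
have ZphiE : (cycle_space D i *m phi i <= cycle_space E i)%MS.
  case: i => [|i]; first by rewrite submx1.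
  by apply/sub_kermxP; rewrite -mulmxA -phiC mulmxA mulmx_ker mul0mx.
have ZDle : (cycle_space D i <= cycle_space E i *m chi i + D i)%MS.
  have -> : cycle_space D i = cycle_space D i *m phi i *m chi i +
                              cycle_space D i *m (1%:M - phi i *m chi i).
    by rewrite mulmxBr mulmx1 mulmxA addrC subrK.
  apply: addmx_sub_adds; first exact: submxMr.
  case: (i) => [|j]; first by rewrite s0 mul1mx submxMl.
  by rewrite sS mulmxDr !mulmxA mulmx_ker mul0mx addr0 submxMl.
have leE : (E i *m chi i <= cycle_space E i *m chi i :&: D i)%MS.
  by rewrite sub_capmx {2}chiC submxMl submxMr // boundary_cycle.
have := mxrank_sum_cap (cycle_space E i *m chi i) (D i).
have := mxrankS ZDle; have := mxrankS leE.
have := mxrank_mul_ker (cycle_space E i) (chi i).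
have := mxrank_mul_ker (E i) (chi i).
have : (\rank (E i :&: kermx (chi i)) <=
        \rank (cycle_space E i :&: kermx (chi i)))%N.
  by apply: mxrankS; rewrite capmxS // boundary_cycle.
rewrite /hdim; lia.
Qed.

Section Tor.
Variables (R : comNzRingType) (k : fieldType) (eps : {rmorphism R -> k}).
Hypothesis eps_onto : forall y, exists x, eps x = y.

Lemma hdim_resolution (f g : nat -> nat) (d : forall i, 'M[R]_(f i.+1, f i))
    (e : forall i, 'M[R]_(g i.+1, g i)) (c : 'cV[k]_(f 0%N)) (b : 'cV[k]_(g 0%N)) :
    is_resolution eps d c -> is_resolution eps e b ->
  forall i, hdim (fun i => map_mx eps (d i)) i =
            hdim (fun i => map_mx eps (e i)) i.
Proof.
move: f g d e c b.
suff le (f g : nat -> nat) (d : forall i, 'M[R]_(f i.+1, f i))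
    (e : forall i, 'M[R]_(g i.+1, g i)) (c : 'cV[k]_(f 0%N)) (b : 'cV[k]_(g 0%N)) :
    is_resolution eps d c -> is_resolution eps e b ->
  forall i, (hdim (fun i => map_mx eps (d i)) i <=
            hdim (fun i => map_mx eps (e i)) i)%N.
  move=> f g d e c b dres eres i; apply/eqP.
  by rewrite eqn_leq !(le _ _ _ _ c b, le _ _ _ _ b c).
move=> dres eres.
have [phi [phi0 phiC]] := chain_map_exists eps_onto dres eres.
have [chi [chi0 chiC]] := chain_map_exists eps_onto eres dres.
have [||s [s0 sS]] := chain_homotopy_exists (psi := fun i => phi i *m chi i) dres.
- by rewrite map_mxM -mulmxA chi0 phi0.
- by move=> i; rewrite mulmxA phiC -!mulmxA chiC.
apply: (@hdim_le _ _ _ _ _ (fun i => map_mx eps (phi i))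
  (fun i => map_mx eps (chi i)) (fun i => map_mx eps (s i))) => [i|i|i|i||i].
- by rewrite -map_mxM (res_complex dres) map_mx0.
- by rewrite -map_mxM (res_complex eres) map_mx0.
- by rewrite -!map_mxM phiC.
- by rewrite -!map_mxM chiC.
- by rewrite -!map_mxM -s0 map_mxB map_mx1.
- by rewrite -!map_mxM -map_mxD -sS map_mxB map_mx1.
Qed.

(** The chosen resolution in the definition of the series can be replaced by any
    other one. *)
Lemma poincare_ofE (f : nat -> nat) (d : forall i, 'M[R]_(f i.+1, f i))
    (c : 'cV[k]_(f 0%N)) : is_resolution eps d c ->
  forall i, poincare_of eps i = (hdim (fun i => map_mx eps (d i)) i)%:R.
Proof.
move=> dres i; rewrite /poincare_of /=; congr _%:R; rewrite /tor_dim.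
have homE (F : free_resolution eps) :
    res_homology_dim F i = hdim (fun i => map_mx eps (res_d F i)) i.
  by rewrite /res_homology_dim /hdim; case: (i) => [|j] //=; rewrite mxrank1.
have resF (F : free_resolution eps) : is_resolution eps (res_d F) (res_aug F).
  split; [|exact: res_exact0|exact: res_exact].
  have /cV0Pn[j cj] := res_aug_onto F.
  have [r rP] := eps_onto (res_aug F j 0)^-1.
  exists (r *: delta_mx 0 j); rewrite map_mxZ map_delta_mx -scalemxAl -rowE.
  by apply/matrixP => ? ?; rewrite !mxE !ord1 rP mulVf.
case: dres => -[u uc] ex0 ex.
have c_neq0 : c != 0.
  apply: contra_eq_neq uc => ->; rewrite mulmx0.
  by apply/eqP => /matrixP/(_ 0 0)/eqP; rewrite !mxE eq_sym oner_eq0.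
pose F := FreeResolution c_neq0 ex0 ex.
case: pselect => [exF|[]]; last by exists (res_homology_dim F i), F.
case: cid => _ [F' /= ->].
by rewrite homE; apply: (hdim_resolution (resF F') (resF F)).
Qed.

End Tor.

(** The resolution 0 -> R of S, when pi is an isomorphism. *)
Section TrivialResolution.
Variables (R S : comNzRingType) (pi : {rmorphism R -> S}).

Definition trivial_rank i : nat := if i is _.+1 then 0 else 1.

Definition trivial_diff i : 'M[R]_(trivial_rank i.+1, trivial_rank i) := 0.

Lemma trivial_resolution : (forall x, pi x = 0 -> x = 0) ->
  is_resolution pi trivial_diff (1%:M : 'cV[S]_1).
Proof.
move=> pi_inj; split; first by exists 1%:M; rewrite map_mx1 mulmx1.
  move=> v; rewrite mulmx1; split=> [piv|[w ->]]; last by rewrite mulmx0 map_mx0.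
  exists 0; rewrite mulmx0; apply/matrixP => i j; rewrite mxE.
  by have /matrixP/(_ i j) := piv; rewrite !mxE => /pi_inj.
move=> i v; split=> _; first by exists 0; rewrite mulmx0 [v]thinmx0.
by rewrite mulmx0.
Qed.

Lemma hdim_trivial (k : fieldType) (eps : {rmorphism R -> k}) n :
  hdim (fun i => map_mx eps (trivial_diff i)) n = (n == 0%N).
Proof.
rewrite hdim_diff !map_mx0 mxrank0 subn0.
by case: n => [|n] //=; rewrite sub0n.
Qed.

End TrivialResolution.

(** * Noetherian rings and existence of resolutions *)

Section Submodules.
Variables (R : nzRingType).
Implicit Types V W : lmodType R.

Definition is_submod V (P : V -> Prop) :=
  P 0 /\ forall a u v, P u -> P v -> P (a *: u + v).

Fixpoint spanned V (s : seq V) (x : V) : Prop :=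
  if s is g :: s' then exists c, spanned s' (x - c *: g) else x = 0.

Definition fin_gen V (P : V -> Prop) :=
  exists s : seq V, (forall x, x \in s -> P x) /\ (forall x, P x -> spanned s x).

Lemma submodD V (P : V -> Prop) u v : is_submod P -> P u -> P v -> P (u + v).
Proof. by case=> _ lin Pu Pv; rewrite -[u]scale1r; apply: lin. Qed.

Lemma submodB V (P : V -> Prop) u v : is_submod P -> P u -> P v -> P (u - v).
Proof. by case=> _ lin Pu Pv; rewrite addrC -scaleN1r; apply: lin. Qed.

Lemma submodZ V (P : V -> Prop) a v : is_submod P -> P v -> P (a *: v).
Proof. by case=> P0 lin Pv; rewrite -[_ *: _]addr0; apply: lin. Qed.

Lemma spanned_sub V (P : V -> Prop) s x :
  is_submod P -> (forall x, x \in s -> P x) -> spanned s x -> P x.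
Proof.
move=> PP; elim: s x => [|g s IH] x sP /=; first by case: PP => ? _ ->.
case=> c /IH Px; rewrite -(subrK (c *: g) x); apply: submodD => //.
  by apply: Px => y ys; apply: sP; rewrite inE ys orbT.
by apply: submodZ => //; apply: sP; rewrite inE eqxx.
Qed.

Lemma spanned_submod V (s : seq V) : is_submod (spanned s).
Proof.
elim: s => [|g s [IH0 IH]]; first by split=> // a u v /= -> ->; rewrite scaler0 addr0.
split; first by exists 0; rewrite scale0r subr0.
move=> a u v [c uc] [d vd]; exists (a * c + d).
have -> : a *: u + v - (a * c + d) *: g = a *: (u - c *: g) + (v - d *: g).
  by rewrite scalerDl scalerBr scalerA opprD addrACA.
exact: IH.
Qed.

Lemma spanned_cat V (s t : seq V) x y :
  spanned s (x - y) -> spanned t y -> spanned (s ++ t) x.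
Proof.
elim: s x => [|g s IH] x /=; first by move=> /eqP; rewrite subr_eq0 => /eqP ->.
by case=> c sx ty; exists c; apply: IH => //; rewrite addrAC.
Qed.

Lemma spanned_map V W (h : {linear V -> W}) s x :
  spanned s x -> spanned (map h s) (h x).
Proof.
elim: s x => [|g s IH] x /=; first by move=> ->; rewrite linear0.
by case=> c /IH; rewrite linearB linearZ; exists c.
Qed.

Lemma spanned_lift V W (h : {linear V -> W}) s x :
  spanned (map h s) (h x) -> exists2 y, spanned s (x - y) & h y = 0.
Proof.
elim: s x => [|g s IH] x /=; first by move=> hx; exists x; rewrite ?subrr.
case=> c; rewrite -linearZ -linearB => /IH[y sy hy].
by exists y => //; exists c; rewrite addrAC.
Qed.

Lemma fin_gen_image V W (h : {linear V -> W}) (P : V -> Prop) :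
  fin_gen P -> fin_gen (fun y => exists2 x, P x & h x = y).
Proof.
case=> s [sP Ps]; exists (map h s); split.
  by move=> _ /mapP[x /sP Px ->]; exists x.
by move=> _ [x /Ps sx <-]; apply: spanned_map.
Qed.

(** Generators of the image, lifted, together with generators of the kernel. *)
Lemma fin_gen_extension V W (h : {linear V -> W}) (P : V -> Prop) :
    is_submod P -> fin_gen (fun y => exists2 x, P x & h x = y) ->
    fin_gen (fun x => P x /\ h x = 0) ->
  fin_gen P.
Proof.
move=> PP [s [sP Ps]] [t [tP Pt]].
have [u [uP hu]] : exists u, (forall x, x \in u -> P x) /\ map h u = s.
  elim: s sP {Ps} => [|y s IH] sP; first by exists [::].
  have [|u [uP hu]] := IH; first by move=> x xs; apply: sP; rewrite inE xs orbT.
  have [|x Px hx] := sP y; first by rewrite inE eqxx.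
  exists (x :: u); split; last by rewrite /= hx hu.
  by move=> z; rewrite inE => /orP[/eqP -> //|/uP].
exists (u ++ t); split.
  by move=> x; rewrite mem_cat => /orP[/uP|/tP[]].
move=> x Px; have [|y uxy hy] := @spanned_lift _ _ h u x.
  by rewrite hu; apply: Ps; exists x.
apply: (spanned_cat uxy); apply: Pt; split=> //.
rewrite -[y](subKr x); apply: submodB => //; exact: spanned_sub uP uxy.
Qed.

End Submodules.

Definition noetherian (R : comNzRingType) :=
  forall P : R^o -> Prop, is_submod P -> fin_gen P.

Lemma noetherian_field (k : fieldType) : noetherian k.
Proof.
move=> P PP; have [[x Px x0]|nP] := pselect (exists2 x, P x & x != 0).
  exists [:: x]; split; first by move=> y; rewrite inE => /eqP ->.
  by move=> y _; exists (y / x); rewrite /= /GRing.scale /= divfK // subrr.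
exists [::]; split=> // x Px /=.
by apply/eqP/negPn/negP => x0; apply: nP; exists x.
Qed.

Lemma noetherian_quotient (R S : comNzRingType) (h : {rmorphism R -> S}) :
  (forall y, exists x, h x = y) -> noetherian R -> noetherian S.
Proof.
move=> onto noeR P [P0 Plin].
have [|s [sP Ps]] := noeR (fun x => P (h x)).
  by split=> [|a u v Pu Pv]; rewrite ?rmorph0 // rmorphD rmorphM; apply: Plin.
exists (map h s); split; first by move=> _ /mapP[x /sP Px ->].
move=> y Py; have [x hx] := onto y; rewrite -hx in Py *.
move: (Ps x Py) => {sP Ps hx Py}.
elim: s x => [|g s IH] x /=; first by move=> ->; rewrite rmorph0.
by case=> c /IH; rewrite rmorphB rmorphM; exists (h c).
Qed.

(** By induction on n: the first coordinates of the elements of P form an ideal,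
    and the elements with first coordinate 0 form a submodule of R^(n-1). *)
Lemma noetherian_row (R : comNzRingType) n (P : 'rV[R]_n -> Prop) :
  noetherian R -> is_submod P -> fin_gen P.
Proof.
move=> noeR; elim: n P => [|n IH] P PP.
  by exists [::]; split=> // x _; rewrite [x]thinmx0.
pose h (v : 'rV[R]_(1 + n)) : R^o := v 0 0.
have h_lin : linear h by move=> a u v; rewrite /h !mxE.
pose hL : {linear _ -> _} :=
  HB.pack h (GRing.isLinear.Build R 'rV[R]_(1 + n) R^o _ h h_lin).
pose g (v : 'rV[R]_n) : 'rV[R]_(1 + n) := row_mx 0 v.
have g_lin : linear g.
  by move=> a u v; rewrite /g -{1}(scaler0 _ a) scale_row_mx add_row_mx addr0.
pose gL : {linear _ -> _} :=
  HB.pack g (GRing.isLinear.Build R 'rV[R]_n 'rV[R]_(1 + n) _ g g_lin).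
apply: (@fin_gen_extension _ _ _ hL) => //.
  apply: noeR; split; first by exists 0; [case: PP|exact: linear0].
  move=> a _ _ [u Pu <-] [v Pv <-]; exists (a *: u + v); last exact: linearP.
  by case: PP => _; apply.
have [|s [sP Ps]] := @fin_gen_image _ _ _ gL _ (IH (fun v => P (g v)) _).
  split=> [|a u v Pu Pv]; first by rewrite [g 0](linear0 gL); case: PP.
  by rewrite [g _](linearP gL); case: PP => _; apply.
exists s; split=> x.
  move=> /sP[v Pv <-]; split=> //; rewrite /= /h /g mxE.
  by case: splitP => // j; rewrite mxE.
case=> Px hx; apply: Ps; have xE : g (rsubmx (x : 'rV_(1 + n))) = x.
  rewrite /g -[RHS]hsubmxK; congr row_mx; apply/rowP => i.
  by rewrite !mxE ord1 -[LHS]hx /= /h; congr (x _ _); apply/val_inj.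
by exists (rsubmx (x : 'rV_(1 + n))); rewrite ?xE.
Qed.

(** Leading terms: the generators are finitely many polynomials whose leading
    coefficients generate all of them, together with generators of the module
    of the polynomials of bounded degree of the ideal. *)
Theorem noetherian_poly (A : comNzRingType) : noetherian A -> noetherian {poly A}.
Proof.
move=> noeA P PP; have [P0 Plin] := PP.
pose lc (x : nat * {poly A}) : A^o := x.2`_x.1.
pose ok (x : nat * {poly A}) := P x.2 /\ (size x.2 <= x.1.+1)%N.
have [|s [sL Ls]] := noeA (fun a => exists2 x, ok x & lc x = a).
  split; first by exists (0%N, 0); rewrite /lc /ok ?coef0 // size_poly0.
  move=> a _ _ [[m p] [/= Pp szp] <-] [[n q] [/= Pq szq] <-].
  exists ((m + n)%N, (a *: 'X^n) * p + 'X^m * q : {poly A}); last first.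
    rewrite /lc /= coefD -scalerAl coefZ !coefXnM.
    by rewrite addnK addKn !ltnNge leq_addr leq_addl.
  split=> /=; first by apply: (Plin _ _ _ Pp); exact: submodZ.
  apply/leq_sizeP => j ltj; rewrite coefD -scalerAl coefZ !coefXnM.
  have [pm qn] : (m.+1 <= j - n)%N /\ (n.+1 <= j - m)%N by lia.
  move/leq_sizeP: szp => /(_ _ pm) ->; move/leq_sizeP: szq => /(_ _ qn) ->.
  by rewrite !if_same mulr0 addr0.
have [t [tok lct]] : exists t, (forall x, x \in t -> ok x) /\ map lc t = s.
  elim: s sL {Ls} => [|y s IH] sL; first by exists [::].
  have [|t [tok lct]] := IH; first by move=> x xs; apply: sL; rewrite inE xs orbT.
  have [|x okx lcx] := sL y; first by rewrite inE eqxx.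
  exists (x :: t); split; last by rewrite /= lcx lct.
  by move=> z; rewrite inE => /orP[/eqP -> //|/tok].
pose N0 := \max_(x <- t) x.1.
(* an element of the ideal of degree N with prescribed leading coefficient *)
have top N (a : A^o) : (N0 <= N)%N -> spanned s a ->
    exists q : {poly A}^o,
      [/\ spanned (map snd t : seq {poly A}^o) q, (size (q : {poly A}) <= N.+1)%N
          & (q : {poly A})`_N = a].
  rewrite -lct {}/N0 {lct sL Ls s}.
  elim: t tok a => [|[n p] t IH] tok a; rewrite ?big_cons.
    by move=> _ /= ->; exists 0; rewrite size_poly0 coef0.
  rewrite geq_max => /andP[/= nN tN] [c /IH]; case=> //.
    by move=> x xt; apply: tok; rewrite inE xt orbT.
  move=> q [tq szq qN].
  have [|/= _ szp] := tok (n, p); first by rewrite inE eqxx.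
  exists (q + (c *: 'X^(N - n)) * p); split.
  - by exists (c *: 'X^(N - n)); rewrite addrK.
  - apply/leq_sizeP => j ltj; rewrite coefD -scalerAl coefZ coefXnM.
    have jn : (n.+1 <= j - (N - n))%N by lia.
    move/leq_sizeP: szp => /(_ _ jn) ->; move/leq_sizeP: szq => /(_ _ ltj) ->.
    by rewrite if_same mulr0 addr0.
  - rewrite coefD -scalerAl coefZ coefXnM qN ltnNge leq_subr subKn //=.
    by rewrite subrK.
have [|w [wP Pw]] := @noetherian_row A N0.+1 (fun v => P (rVpoly v)) noeA.
  split=> [|a u v Pu Pv]; first by rewrite linear0.
  have -> : rVpoly (a *: u + v) = a%:P * rVpoly u + rVpoly v.
    by rewrite linearP mul_polyC.
  exact: Plin.
have low (p : {poly A}^o) : P p -> (size (p : {poly A}) <= N0.+1)%N ->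
    spanned (map (@rVpoly _ _) w : seq {poly A}^o) p.
  move=> Pp szp; rewrite -[p](poly_rV_K szp) in Pp *; move: {szp}(Pw _ Pp).
  move: (poly_rV _) => v {Pp}; elim: w v {wP Pw} => [|g w IH] v /=.
    by move=> ->; rewrite linear0.
  case=> c /IH; have -> : rVpoly (v - c *: g) = rVpoly v - c%:P * rVpoly g.
    by rewrite linearB linearZ mul_polyC.
  by exists c%:P.
exists ((map snd t : seq {poly A}^o) ++ map (@rVpoly _ _) w); split.
  move=> x; rewrite mem_cat => /orP[] /mapP[y]; first by case/tok=> ? _ ->.
  by move=> /wP ? ->.
have spanW := spanned_submod ((map snd t : seq {poly A}^o) ++ map (@rVpoly _ _) w).
move=> p; have [n] := ubnP (size (p : {poly A})); elim: n p => // n IH p szp Pp.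
have [lowp|highp] := leqP (size (p : {poly A})) N0.+1.
  apply: (@spanned_cat _ _ _ _ _ p); last exact: low.
  by rewrite subrr; case: (spanned_submod (map snd t : seq {poly A}^o)).
pose N := (size (p : {poly A})).-1; have szN : size (p : {poly A}) = N.+1 by lia.
have [||q [tq szq qN]] := top N (p : {poly A})`_N.
- lia.
- by apply: Ls; exists (N, p : {poly A}); rewrite /ok //= szN.
have Pq : P q.
  by apply: spanned_sub tq => // x /mapP[y /tok[Py _] ->].
rewrite -(subrK q p); apply: submodD => //; last first.
  apply: (@spanned_cat _ _ _ _ _ 0); first by rewrite subr0.
  by case: (spanned_submod (map (@rVpoly _ _) w : seq {poly A}^o)).
apply: IH; last exact: submodB.
rewrite -ltnS; apply: leq_trans szp; rewrite szN !ltnS.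
apply/leq_sizeP => j; rewrite leq_eqVlt => /orP[/eqP <-|ltj].
  by rewrite coefB qN subrr.
rewrite coefB; move/leq_sizeP: szq => /(_ _ ltj) ->.
by rewrite nth_default ?szN // subr0.
Qed.

Lemma mpoly_closed_ind (R : comNzRingType) n (P : {mpoly R[n]} -> Prop) :
    (forall c, P c%:MP) -> (forall i, P 'X_i) ->
    (forall p q, P p -> P q -> P (p + q)) -> (forall p q, P p -> P q -> P (p * q)) ->
  forall p, P p.
Proof.
move=> PC PX PD PM p; rewrite (mpolyE p).
apply: big_rec => [|m q _]; first exact: PC 0.
apply: (PD); rewrite -mul_mpolyC; apply: (PM) => //; rewrite mpolyXE_id.
apply: big_rec => [|i r _]; first exact: PC 1.
by apply: (PM); elim: (m i) => [|j IH]; rewrite ?expr0 ?exprS; [exact: PC 1|exact: PM].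
Qed.

Theorem noetherian_mpoly (k : fieldType) n : noetherian {mpoly k[n]}.
Proof.
elim: n => [|n IH].
  apply: (@noetherian_quotient k _ (@mpolyC 0 k)); last exact: noetherian_field.
  by move=> p; exists p@_0%MM; exact/esym/nvar0_mpolyC.
have comm : commr_rmorph (@mwiden n k) 'X_ord_max by move=> p; exact: mulrC.
apply: (@noetherian_quotient _ _ (horner_morph comm)); last exact: noetherian_poly.
apply: mpoly_closed_ind => [c|i|_ _ [p <-] [q <-]|_ _ [p <-] [q <-]].
- by exists (c%:MP)%:P; rewrite /= horner_morphC /= mwidenC.
- have [->|i_neq] := eqVneq i ord_max; first by exists 'X; rewrite /= horner_morphX.
  have lti : (i < n)%N.
    have := ltn_ord i; rewrite ltnS leq_eqVlt => /orP[/eqP e|//].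
    by case/eqP: i_neq; apply/val_inj.
  exists ('X_(Ordinal lti))%:P; rewrite /= horner_morphC /= /mwiden mmapX mmap1U.
  by congr 'X__; apply/val_inj.
- by exists (p + q); rewrite rmorphD.
- by exists (p * q); rewrite rmorphM.
Qed.

Lemma fin_gen_matrix (R : comNzRingType) n (P : 'rV[R]_n -> Prop) :
    is_submod P -> fin_gen P ->
  exists M : {m & 'M[R]_(m, n)}, forall v, P v <-> exists w, v = w *m projT2 M.
Proof.
move=> PP [s [sP Ps]]; exists (existT _ (size s) (\matrix_i s`_i)) => /= v.
split=> [/Ps|[w ->]].
  elim: s v {sP Ps} => [|g s IH] v /=; first by move=> ->; exists 0; rewrite mul0mx.
  case=> c /IH[w wP]; exists (row_mx c%:M w : 'rV_(1 + size s)).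
  have colE : col_mx g (\matrix_i s`_i) = \matrix_(i < 1 + size s) (g :: s)`_i.
    apply/matrixP => i j; rewrite !mxE.
    by case: splitP => i' e; rewrite ?mxE e //= ord1.
  transitivity (row_mx c%:M w *m col_mx g (\matrix_i s`_i)); last by rewrite colE.
  by rewrite mul_row_col mul_scalar_mx -wP addrC subrK.
rewrite mulmx_sum_row; elim/big_rec: _ => [|i x _ Px]; first by case: PP.
by case: PP => _; apply=> //; rewrite rowK; apply: sP; rewrite mem_nth.
Qed.

(** Each step resolves the kernel of the previous matrix, which is finitely
    generated. *)
Theorem resolution_exists (R S : comNzRingType) (pi : {rmorphism R -> S}) :
    noetherian R -> exists (f : nat -> nat) (d : forall i, 'M[R]_(f i.+1, f i)) c,
  is_resolution pi d c.
Proof.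
move=> noeR.
have kerP n (M : {m & 'M[R]_(m, n)}) : exists N : {p & 'M[R]_(p, projT1 M)},
    forall v : 'rV_(projT1 M), v *m projT2 M = 0 <-> exists w, v = w *m projT2 N.
  have PP : is_submod (fun v : 'rV_(projT1 M) => v *m projT2 M = 0).
    split=> [|a u v uM vM]; first by rewrite mul0mx.
    by rewrite mulmxDl -scalemxAl uM vM scaler0 addr0.
  exact: (fin_gen_matrix PP (noetherian_row noeR PP)).
have [M0 M0P] : exists M : {m & 'M[R]_(m, 1)}, forall v : 'rV_1,
    map_mx pi v *m (1%:M : 'cV_1) = 0 <-> exists w, v = w *m projT2 M.
  have PP : is_submod (fun v : 'rV_1 => map_mx pi v *m (1%:M : 'cV_1) = 0).
    split=> [|a u v uM vM]; first by rewrite map_mx0 mul0mx.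
    by rewrite map_mxD map_mxZ mulmxDl -scalemxAl uM vM scaler0 addr0.
  exact: (fin_gen_matrix PP (noetherian_row noeR PP)).
pose state := {n & {m & 'M[R]_(m, n)}}.
pose next (x : state) : state :=
  existT _ (projT1 (projT2 x)) (sval (cid (kerP _ (projT2 x)))).
pose chain i : state := iter i next (existT _ 1%N M0).
exists (fun i => projT1 (chain i)), (fun i => projT2 (projT2 (chain i))), 1%:M.
split=> //; first by exists 1%:M; rewrite map_mx1 mulmx1.
by move=> i v /=; exact: (svalP (cid (kerP _ (projT2 (chain i))))).
Qed.

Lemma fps_coefXM (K : fieldType) (g : fps K) n :
  (fpsX * g) n = if n is m.+1 then g m else 0.
Proof.
rewrite fps_coefM; case: n => [|n]; first by rewrite big_ord1 mul0r.
rewrite 2!big_ord_recl /= mul0r mul1r add0r subSS subn0 big1 ?addr0 // => i _.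
by rewrite mul0r.
Qed.

(** * Killing a regular element outside the square of the maximal ideal *)

Section RegularElement.
Variables (B C : comNzRingType) (k : fieldType).
Variables (pi : {rmorphism B -> C}).
Variables (epsB : {rmorphism B -> k}) (eps : {rmorphism C -> k}).
Hypothesis pi_onto : forall y, exists x, pi x = y.
Hypothesis eps_onto : forall y, exists x, eps x = y.
Hypothesis epsE : forall x, eps (pi x) = epsB x.
Variable f : B.
Hypothesis f_reg : forall x, f * x = 0 -> x = 0.
Hypothesis pi_ker : forall x, pi x = 0 <-> exists y, x = f * y.
Variable del : {additive B -> k}.
Hypothesis delM : forall x y, del (x * y) = epsB x * del y + del x * epsB y.
Hypothesis del_f : del f = 1.

(** A resolution d over C is lifted to matrices dt over B; they fail to be a
    complex, and s measures by how much. *)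
Section Lift.
Variables (g : nat -> nat) (d : forall i, 'M[C]_(g i.+1, g i)) (c : 'cV[k]_(g 0%N)).
Hypothesis dres : is_resolution eps d c.
Variable dt : forall i, 'M[B]_(g i.+1, g i).
Hypothesis dtE : forall i, map_mx pi (dt i) = d i.
Variable s : forall i, 'M[B]_(g i.+2, g i).
Hypothesis sE : forall i, dt i.+1 *m dt i = f *: s i.

Let pif : pi f = 0. Proof. by apply/pi_ker; exists 1; rewrite mulr1. Qed.

Let ker_mx m n (A : 'M[B]_(m, n)) : map_mx pi A = 0 -> exists X, A = f *: X.
Proof.
move=> A0; have fA i j : exists y, A i j = f * y.
  by apply/pi_ker; move/matrixP: A0 => /(_ i j); rewrite !mxE.
exists (\matrix_(i, j) sval (cid (fA i j))).
by apply/matrixP => i j; rewrite !mxE; case: cid.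
Qed.

Let reg_mx m n (A : 'M[B]_(m, n)) : f *: A = 0 -> A = 0.
Proof.
move=> /matrixP fA; apply/matrixP => i j; rewrite mxE; apply: f_reg.
by have := fA i j; rewrite !mxE.
Qed.

Let s_comm i : dt i.+2 *m s i = s i.+1 *m dt i.
Proof.
apply/eqP; rewrite -subr_eq0; apply/eqP/reg_mx.
by rewrite scalerBr scalemxAr -sE scalemxAl -sE mulmxA subrr.
Qed.

Definition reg_rank i : nat := match i with 0%N => g 0%N | j.+1 => (g j.+1 + g j)%N end.

(** The sum of two copies of the lift, the second one shifted by a degree, with
    differential (a, b) |-> (a dt + f b, - (a s + b dt)). *)
Definition reg_diff i : 'M[B]_(reg_rank i.+1, reg_rank i) :=
  match i return 'M[B]_(reg_rank i.+1, reg_rank i) with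
  | 0%N => col_mx (dt 0) f%:M
  | j.+1 => block_mx (dt j.+1) (- s j) f%:M (- dt j)
  end.

Let reg_diffM i : reg_diff i.+1 *m reg_diff i = 0.
Proof.
case: i => [|i] /=.
  rewrite mul_block_col !mul_mx_scalar !mul_scalar_mx sE !scalerN !subrr.
  by rewrite col_mx0.
rewrite mulmx_block !mul_mx_scalar !mul_scalar_mx !mulNmx !mulmxN opprK !sE s_comm.
by rewrite !scalerN !(subrr, addNr) block_mx0.
Qed.

Let row0l m n1 n2 (X : 'M[B]_(m, n1)) (Y : 'M_(m, n2)) : row_mx X Y = 0 -> X = 0.
Proof. by move=> /(congr1 lsubmx); rewrite row_mxKl linear0. Qed.

(* a cycle whose first component is zero vanishes, as f is regular *)
Let reg_cycle i (b : 'rV_(g i)) :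
  (row_mx 0 b : 'rV_(reg_rank i.+1)) *m reg_diff i = 0 -> b = 0.
Proof.
case: i b => [|i] b /=.
  rewrite mul_row_col mul0mx add0r mul_mx_scalar; exact: reg_mx.
rewrite mul_row_block !mul0mx !add0r mul_mx_scalar.
by move=> /row0l/reg_mx.
Qed.

Let pi_scalar m n (A : 'M[B]_(m, n)) : map_mx pi (f *: A) = 0.
Proof. by rewrite map_mxZ pif scale0r. Qed.

Let lift_boundary i (a : 'rV_(g i.+1)) : map_mx pi a *m d i = 0 ->
  exists w y, a = w *m dt i.+1 + f *: y.
Proof.
case: dres => _ _ ex /ex[w wP]; have [W WE] := map_mx_lift pi_onto w.
have [|y yP] := @ker_mx _ _ (a - W *m dt i.+1).
  by rewrite map_mxB map_mxM dtE WE -wP subrr.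
by exists W, y; rewrite -yP addrC subrK.
Qed.

Lemma reg_resolution : is_resolution epsB reg_diff c.
Proof.
have epsmx m n (A : 'M[B]_(m, n)) : map_mx epsB A = map_mx eps (map_mx pi A).
  by apply/matrixP => i j; rewrite !mxE epsE.
have [[u uP] ex0 _] := dres; split.
- have [v vE] := map_mx_lift pi_onto u; exists v.
  by rewrite epsmx vE.
- move=> v; rewrite epsmx ex0; split=> [[w wP]|[w ->]].
    have [W WE] := map_mx_lift pi_onto w.
    have [|y yP] := @ker_mx _ _ (v - W *m dt 0).
      by rewrite map_mxB map_mxM dtE WE -wP subrr.
    exists (row_mx W y : 'rV_(reg_rank 1)).
    by rewrite /= mul_row_col mul_mx_scalar -yP addrC subrK.
  exists (map_mx pi (lsubmx (w : 'rV_(g 1%N + g 0%N)))).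
  rewrite -[w]hsubmxK /= mul_row_col mul_mx_scalar map_mxD pi_scalar addr0.
  by rewrite map_mxM dtE row_mxKl.
move=> i v; split=> [vD|[w ->]]; last by rewrite -mulmxA reg_diffM mulmx0.
have {vD}[a [b [vE vD]]] : exists a b, v = row_mx a b /\
    (row_mx a b : 'rV_(reg_rank i.+1)) *m reg_diff i = 0.
  by exists (lsubmx (v : 'rV_(g i.+1 + g i))), (rsubmx (v : 'rV_(g i.+1 + g i)));
    rewrite hsubmxK.
have [w [y aE]] : exists w y, a = w *m dt i.+1 + f *: y.
  apply: lift_boundary; rewrite -dtE -map_mxM.
  case: (i) a b vD {vE} => [|j] a b.
    rewrite /= mul_row_col mul_mx_scalar => /(congr1 (map_mx pi)).
    by rewrite map_mxD pi_scalar addr0 map_mx0.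
  rewrite /= mul_row_block mul_mx_scalar => /row0l.
  by move=> /(congr1 (map_mx pi)); rewrite map_mxD pi_scalar addr0 map_mx0.
exists (row_mx w y : 'rV_(reg_rank i.+2)); rewrite vE.
have wyE : (row_mx w y : 'rV_(reg_rank i.+2)) *m reg_diff i.+1 =
    row_mx a (- (w *m s i) - y *m dt i).
  by rewrite /= mul_row_block mul_mx_scalar -aE !mulmxN.
rewrite wyE; congr row_mx; apply/eqP; rewrite -subr_eq0; apply/eqP.
apply: reg_cycle; rewrite -(subrr a) -add_row_mx -opp_row_mx -wyE mulmxBl vD.
by rewrite -mulmxA reg_diffM mulmx0 subrr.
Qed.

Let del_mxM m n p (X : 'M[B]_(m, n)) (Y : 'M_(n, p)) :
  map_mx del (X *m Y) = map_mx epsB X *m map_mx del Y + map_mx del X *m map_mx epsB Y.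
Proof.
apply/matrixP => i j; rewrite !mxE raddf_sum -big_split.
by apply: eq_bigr => l _; rewrite !mxE delM.
Qed.

Let epsf : epsB f = 0. Proof. by rewrite -epsE pif rmorph0. Qed.

(** The identity dt dt = f s differentiates to a null homotopy of s. *)
Let s_null i : let E i := map_mx epsB (dt i) in
  map_mx epsB (s i) =
  E i.+1 *m map_mx del (dt i) + map_mx del (dt i.+1) *m E i.
Proof.
rewrite /= -del_mxM sE; apply/matrixP => a b.
by rewrite !mxE delM epsf mul0r add0r del_f mul1r.
Qed.

(** Modulo the augmentation ideal the differential is conjugate to the direct sum
    of the two copies, because s is null homotopic. *)
Lemma reg_hdim i : hdim (fun i => map_mx epsB (reg_diff i)) i =
  (hdim (fun i => map_mx eps (d i)) i +
   if i is j.+1 then hdim (fun i => map_mx eps (d i)) j else 0)%N.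
Proof.
pose E i := map_mx eps (d i).
have EE j : E j.+1 *m E j = 0 by rewrite -map_mxM (res_complex dres) map_mx0.
have epsd j : map_mx epsB (dt j) = E j.
  by rewrite /E -dtE; apply/matrixP => a b; rewrite !mxE epsE.
have leE j : (\rank (E j.+1) + \rank (E j) <= g j.+1)%N by exact: mulmx0_rank_max.
have epsfM n : map_mx epsB (f%:M : 'M_n) = 0 by rewrite map_scalar_mx /= epsf raddf0.
have rk0 : \rank (map_mx epsB (reg_diff 0)) = \rank (E 0%N).
  by rewrite /= map_col_mx epsfM epsd rank_col_mx0.
have rkS j : \rank (map_mx epsB (reg_diff j.+1)) = (\rank (E j.+1) + \rank (E j))%N.
  rewrite /= map_block_mx epsfM !map_mxN s_null !epsd.
  set th := map_mx del _; set th' := map_mx del _.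
  have -> : block_mx (E j.+1) (- (E j.+1 *m th + th' *m E j)) 0 (- E j) =
      block_mx 1%:M th' 0 1%:M *m block_mx (E j.+1) 0 0 (- E j)
      *m block_mx 1%:M (- th) 0 1%:M.
    rewrite !mulmx_block !(mul0mx, mulmx0, mul1mx, mulmx1, addr0, add0r).
    by rewrite !mulmxN -opprD.
  have unit_u m n (X : 'M[k]_(m, n)) : block_mx 1%:M X 0 1%:M \in unitmx.
    by rewrite unitmxE det_ublock !det1 mulr1 unitr1.
  rewrite mxrankMfree ?row_free_unit // (eqmxMfull _ _) ?row_full_unit //.
  by rewrite rank_diag_block_mx mxrank_opp.
case: i => [|[|i]]; rewrite !hdim_diff ?rkS ?rk0 -?/(E _) /=.
- by rewrite subn0 addn0.
- have := leE 0%N; have := leE 1%N.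
  have := rank_leq_col (E 0%N); lia.
- have := leE i; have := leE i.+1; have := leE i.+2; lia.
Qed.

End Lift.

(** The derivation del expresses that f is not in the square of the augmentation
    ideal. *)
Theorem poincare_regular_element : noetherian C ->
  poincare_of epsB = (1 + fpsX) * poincare_of eps.
Proof.
move=> noeC; have [g [d [c dres]]] := resolution_exists eps noeC.
have [dt dtE] : exists dt : forall i, 'M[B]_(g i.+1, g i),
    forall i, map_mx pi (dt i) = d i.
  pose ex i := cid (map_mx_lift pi_onto (d i)).
  by exists (fun i => sval (ex i)) => i; exact: (svalP (ex i)).
have [s sE] : exists s : forall i, 'M[B]_(g i.+2, g i),
    forall i, dt i.+1 *m dt i = f *: s i.
  have ex i : exists s : 'M[B]_(g i.+2, g i), dt i.+1 *m dt i = f *: s.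
    have dd : map_mx pi (dt i.+1 *m dt i) = 0.
      by rewrite map_mxM !dtE (res_complex dres).
    have fA a b : exists y, (dt i.+1 *m dt i) a b = f * y.
      by apply/pi_ker; move/matrixP: dd => /(_ a b); rewrite !mxE.
    exists (\matrix_(a, b) sval (cid (fA a b))).
    by apply/matrixP => a b; rewrite [RHS]mxE [X in _ = f * X]mxE; case: cid.
  by exists (fun i => sval (cid (ex i))) => i; exact: (svalP (cid (ex i))).
have epsB_onto y : exists x, epsB x = y.
  have [z <-] := eps_onto y; have [x <-] := pi_onto z.
  by exists x; rewrite epsE.
apply: fpsP => n; rewrite mulrDl mul1r fps_coefD fps_coefXM.
rewrite (poincare_ofE epsB_onto (reg_resolution dres dtE sE)).
rewrite (reg_hdim dres dtE sE) natrD (poincare_ofE eps_onto dres).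
by case: n => [|n] //; rewrite (poincare_ofE eps_onto dres).
Qed.

End RegularElement.

(** * Tensor products of complexes *)

(** An element of degree n of the tensor product of two complexes is given by its
    components v i j with i + j = n, an element of the tensor product of free
    modules of ranks f i and g j being a matrix. Families are indexed by all i
    and j, so that no component has a type that depends on n - i, and are compared
    on the components with i + j = n. *)
Definition family (R : Type) (f g : nat -> nat) := forall i j, 'M[R]_(f i, g j).

Definition tensor_rank (f g : nat -> nat) n := (\sum_(i < n.+1) f i * g (n - i))%N.

Section Packing.
Variables (R : comNzRingType).
Implicit Types f g : nat -> nat.

Definition fam_lin f g f' g' (L : family R f g -> family R f' g') :=
  forall a u v i j,
    L (fun i j => a *: u i j + v i j) i j = a *: L u i j + L v i j.

Definition pack f g n (v : family R f g) : 'rV[R]_(tensor_rank f g n) :=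
  \mxrow_(i < n.+1) mxvec (v i (n - i)%N).

Lemma antidiag_ltn n i j : (i + j)%N = n -> (i < n.+1)%N.
Proof. by move=> <-; rewrite ltnS leq_addr. Qed.

Lemma antidiag_sub n i j : (i + j)%N = n -> (n - i)%N = j.
Proof. by move=> <-; rewrite addKn. Qed.

Definition unpack f g n (w : 'rV[R]_(tensor_rank f g n)) : family R f g :=
  fun i j => match (i + j)%N =P n with
  | ReflectT e => castmx (erefl, congr1 g (antidiag_sub e))
      (vec_mx (submxrow w (Ordinal (antidiag_ltn e))))
  | ReflectF _ => 0
  end.

Lemma unpack_linear f g n a (u v : 'rV[R]_(tensor_rank f g n)) :
  unpack (a *: u + v) = (fun i j => a *: unpack u i j + unpack v i j).
Proof.
apply: functional_extensionality_dep => i; apply: functional_extensionality_dep => j.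
rewrite /unpack; case: eqP => [e|_]; last by rewrite scaler0 addr0.
by apply/matrixP => x y; rewrite !(castmxE, mxE).
Qed.

Lemma packK f g n (v : family R f g) i j :
  (i + j)%N = n -> unpack (pack n v) i j = v i j.
Proof.
move=> ijn; rewrite /unpack; case: eqP => // e; rewrite /pack mxrowK mxvecK /=.
by move: (antidiag_sub e) => E {e ijn}; case: j / E; rewrite castmx_id.
Qed.

Lemma unpackP f g n (u v : 'rV[R]_(tensor_rank f g n)) :
  (forall i j, (i + j)%N = n -> unpack u i j = unpack v i j) -> u = v.
Proof.
move=> uv; apply/mxrowP => -[i lti]; apply: (can_inj vec_mxK).
have e : (i + (n - i))%N = n by rewrite subnKC // -ltnS.
have := uv i (n - i)%N e; rewrite /unpack; case: eqP => // e'.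
rewrite (bool_irrelevance (antidiag_ltn e') lti).
by move: (congr1 g _) => eg /=; rewrite !castmx_id.
Qed.

Lemma unpack0 f g n i j : unpack (0 : 'rV[R]_(tensor_rank f g n)) i j = 0.
Proof.
rewrite /unpack; case: eqP => // e.
by apply/matrixP => x y; rewrite !(castmxE, mxE).
Qed.

Lemma pack_linear f g f' g' n n' (L : family R f g -> family R f' g') :
  fam_lin L -> linear (fun w => pack n' (L (unpack (n := n) w))).
Proof.
move=> Llin a u v; rewrite unpack_linear /pack; apply/mxrowP => i.
rewrite submxrowD !mxrowK Llin linearD linearZ /=; congr (_ + _).
have submxrowZ (A : 'rV[R]_(tensor_rank f' g' n')) :
    submxrow (a *: A) i = a *: submxrow A i.
  by apply/rowP => j; rewrite !mxE.
by rewrite submxrowZ mxrowK.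
Qed.

Definition fam_mx f g f' g' n n' (L : family R f g -> family R f' g') :
    'M[R]_(tensor_rank f g n, tensor_rank f' g' n') :=
  lin1_mx (fun w => pack n' (L (unpack w))).

Lemma mul_fam_mx f g f' g' n n' (L : family R f g -> family R f' g') w :
  fam_lin L -> w *m fam_mx n n' L = pack n' (L (unpack w)).
Proof.
move=> /(@pack_linear _ _ _ _ n n') Llin.
pose LL : {linear _ -> _} := HB.pack (fun w => pack n' (L (unpack w)))
  (GRing.isLinear.Build R 'rV[R]_(tensor_rank f g n) 'rV[R]_(tensor_rank f' g' n')
     _ _ Llin).
exact: (mul_rV_lin1 LL).
Qed.

Lemma fam_mxP m f g n (A B : 'M[R]_(m, tensor_rank f g n)) :
    (forall w i j, (i + j)%N = n -> unpack (w *m A) i j = unpack (w *m B) i j) ->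
  A = B.
Proof.
move=> AB; apply/row_matrixP => i; rewrite !rowE; apply: unpackP => *.
exact: AB.
Qed.

End Packing.

Section PackMap.
Variables (R S : comNzRingType) (h : {rmorphism R -> S}).

Lemma unpack_map f g n (w : 'rV[R]_(tensor_rank f g n)) :
  unpack (map_mx h w) = (fun i j => map_mx h (unpack w i j)).
Proof.
apply: functional_extensionality_dep => i; apply: functional_extensionality_dep => j.
rewrite /unpack; case: eqP => [e|_]; last by rewrite map_mx0.
by apply/matrixP => x y; rewrite !(castmxE, mxE).
Qed.

Lemma map_fam_mx f g f' g' n n' (L : family R f g -> family R f' g')
    (L' : family S f g -> family S f' g') :
    (forall v i j, map_mx h (L v i j) = L' (fun i j => map_mx h (v i j)) i j) ->
  map_mx h (fam_mx n n' L) = fam_mx n n' L'.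
Proof.
move=> LL'; apply/row_matrixP => i; rewrite -map_row.
have rowE' (T : comNzRingType) (M : family T f g -> family T f' g') :
  row i (fam_mx n n' M) = pack n' (M (unpack (delta_mx 0 i))).
  by apply/rowP => j; rewrite !mxE.
rewrite !rowE' /pack -(map_delta_mx h) unpack_map; apply/mxrowP => j.
have map_submxrow (A : 'rV[R]_(tensor_rank f' g' n')) :
    submxrow (map_mx h A) j = map_mx h (submxrow A j).
  by apply/rowP => x; rewrite !mxE.
by rewrite map_submxrow !mxrowK -LL' -map_mxvec.
Qed.

End PackMap.

Section TensorDifferential.
Variables (R : comNzRingType) (f g : nat -> nat).
Variables (F : forall i, 'M[R]_(f i.+1, f i)) (G : forall j, 'M[R]_(g j.+1, g j)).

Definition tdiff (v : family R f g) : family R f g := fun i j =>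
  (F i)^T *m v i.+1 j + (-1) ^+ i *: (v i j.+1 *m G j).

Lemma tdiff_lin : fam_lin tdiff.
Proof.
move=> a u v i j; rewrite /tdiff mulmxDr mulmxDl -scalemxAr -scalemxAl.
by rewrite !scalerDr !scalerA (mulrC a) addrACA.
Qed.

Lemma eq_tdiff n (u v : family R f g) :
  (forall i j, (i + j)%N = n.+1 -> u i j = v i j) ->
  forall i j, (i + j)%N = n -> tdiff u i j = tdiff v i j.
Proof. by move=> uv i j ijn; rewrite /tdiff !uv // ?addSn ?addnS ijn. Qed.

Lemma tdiffD u v i j :
  tdiff (fun i j => u i j + v i j) i j = tdiff u i j + tdiff v i j.
Proof.
have <- : (fun i j => 1 *: u i j + v i j) = (fun i j => u i j + v i j).
  by do 2!apply: functional_extensionality_dep => ?; rewrite scale1r.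
by rewrite tdiff_lin scale1r.
Qed.

Lemma tdiffB u v i j :
  tdiff (fun i j => u i j - v i j) i j = tdiff u i j - tdiff v i j.
Proof.
have <- : (fun i j => -1 *: v i j + u i j) = (fun i j => u i j - v i j).
  by do 2!apply: functional_extensionality_dep => ?; rewrite scaleN1r addrC.
by rewrite tdiff_lin scaleN1r addrC.
Qed.

Hypothesis FF : forall i, F i.+1 *m F i = 0.
Hypothesis GG : forall i, G i.+1 *m G i = 0.

Lemma tdiff_complex v i j : tdiff (tdiff v) i j = 0.
Proof.
rewrite /tdiff !mulmxDr !mulmxDl !mulmxA -!trmx_mul FF trmx0 mul0mx add0r.
rewrite -!scalemxAl -!scalemxAr -!mulmxA GG !mulmx0 scaler0 addr0.
by rewrite exprS mulN1r scaleNr addNr.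
Qed.

End TensorDifferential.

Section Kunneth.
Variables (k : fieldType) (f g : nat -> nat).
Variables (E : forall i, 'M[k]_(f i.+1, f i)) (G : forall j, 'M[k]_(g j.+1, g j)).
Hypotheses (EE : forall i, E i.+1 *m E i = 0) (GG : forall i, G i.+1 *m G i = 0).

Section Homotopy.
Variables (h : nat -> nat) (P : forall i, 'M[k]_(h i, f i)).
Variables (Q : forall i, 'M[k]_(f i, h i)) (s : forall i, 'M[k]_(f i, f i.+1)).
Hypotheses (PE : forall i, P i.+1 *m E i = 0) (EQ : forall i, E i *m Q i = 0).
Hypotheses (QP0 : Q 0%N *m P 0%N = 1%:M - s 0%N *m E 0%N).
Hypothesis QPS : forall i, Q i.+1 *m P i.+1 = 1%:M - s i.+1 *m E i.+1 - E i *m s i.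
Variables (h' : nat -> nat) (P' : forall i, 'M[k]_(h' i, g i)).
Variables (Q' : forall i, 'M[k]_(g i, h' i)) (s' : forall i, 'M[k]_(g i, g i.+1)).
Hypotheses (QP0' : Q' 0%N *m P' 0%N = 1%:M - s' 0%N *m G 0%N).
Hypothesis QPS' : forall i, Q' i.+1 *m P' i.+1 = 1%:M - s' i.+1 *m G i.+1 - G i *m s' i.

(** The homotopy s (x) 1 + QP (x) s'. *)
Definition tensor_htpy (v : family k f g) : family k f g := fun i j =>
  (match i return 'M_(f i, g j) with
   | 0%N => 0 | i'.+1 => (s i')^T *m v i' j end) +
  (match j return 'M_(f i, g j) with
   | 0%N => 0
   | j'.+1 => (-1) ^+ i *: ((Q i *m P i)^T *m v i j' *m s' j') end).

(** The homotopy bounds every cycle of trivial class: on a cycle the terms that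
    mix s with G become terms in E and s, and those that mix s' with E vanish
    because P E = 0 and E Q = 0. *)
Lemma tensor_htpyP n (v : family k f g) :
    (forall i j, (i + j).+1 = n -> tdiff E G v i j = 0) ->
    (forall i j, (i + j)%N = n -> (Q i)^T *m v i j *m Q' j = 0) ->
  forall i j, (i + j)%N = n -> v i j = tdiff E G (tensor_htpy v) i j.
Proof.
move=> vcyc vQ i j ij.
have sgn2 m p (A : 'M[k]_(m, p)) : (-1) ^+ i *: ((-1) ^+ i *: A) = A.
  by rewrite scalerA -exprD addnn -signr_odd odd_double scale1r.
have left_part : (1%:M - Q i *m P i)^T *m v i j = (s i *m E i)^T *m v i j +
    (-1) ^+ i *: ((match i return 'M_(f i, g j.+1) with
       | 0%N => 0 | i'.+1 => (s i')^T *m v i' j.+1 end) *m G j).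
  case: i ij {sgn2} => [|i] ij.
    by rewrite QP0 mul0mx scaler0 addr0 opprB addrC subrK.
  rewrite QPS !opprD !opprK !addrA subrr add0r.
  rewrite linearD /= mulmxDl; congr (_ + _).
  have /eqP := vcyc i j ij; rewrite addr_eq0 => /eqP eE.
  by rewrite trmx_mul -!mulmxA eE mulmxN -scalemxAr exprS mulN1r scaleNr.
have right_part : (Q i *m P i)^T *m v i j = (Q i *m P i)^T *m v i j *m (s' j *m G j).
  have QPv : (Q i *m P i)^T *m v i j *m (Q' j *m P' j) = 0.
    by rewrite trmx_mul -!mulmxA [v i j *m _]mulmxA [(Q i)^T *m _]mulmxA
      [(Q i)^T *m _]mulmxA vQ // mul0mx mulmx0.
  apply/eqP; rewrite -subr_eq0 -[X in X - _]mulmx1 -mulmxBr; apply/eqP.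
  case: j ij {left_part} QPv => [|j] ij QPv; first by rewrite -QP0'.
  rewrite -(subrK (G j *m s' j) (1%:M - _)) -QPS' mulmxDr QPv add0r mulmxA.
  have ij' : (i + j).+1 = n by rewrite -addnS.
  have /eqP := vcyc i j ij'; rewrite /tdiff addrC addr_eq0 => /eqP eE.
  rewrite -[_ *m v i j.+1 *m G j]mulmxA -[v i j.+1 *m G j]sgn2 eE.
  rewrite scalerN mulmxN -scalemxAr mulmxA -trmx_mul mulmxA EQ mul0mx trmx0 mul0mx.
  by rewrite scaler0 oppr0 mul0mx.
rewrite /tdiff /tensor_htpy mulmxDr mulmxDl scalerDr.
have -> : (E i)^T *m (match j return 'M_(f i.+1, g j) with
   | 0%N => 0
   | j'.+1 => (-1) ^+ i.+1 *: ((Q i.+1 *m P i.+1)^T *m v i.+1 j' *m s' j') end) = 0.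
  case: (j) => [|j']; first by rewrite mulmx0.
  rewrite -scalemxAr !mulmxA -trmx_mul -[Q i.+1 *m _ *m _]mulmxA PE.
  by rewrite mulmx0 trmx0 !mul0mx scaler0.
rewrite addr0 mulmxA -trmx_mul addrA -left_part -scalemxAl sgn2.
rewrite -[_ *m s' j *m G j]mulmxA -right_part.
by rewrite -mulmxDl -linearD /= subrK trmx1 mul1mx.
Qed.

End Homotopy.

(** Representatives and coordinates of homology classes of the tensor product are
    tensor products of those of the factors. *)
Theorem kunneth n : hdim (fun n => fam_mx n.+1 n (tdiff E G)) n =
  (\sum_(i < n.+1) hdim E i * hdim G (n - i))%N.
Proof.
have [h [P [Q [s [hE PE EQ PQ [QP0 QPS]]]]]] := complex_splitting EE.
have [h' [P' [Q' [s' [hG PG GQ PQ' [QP0' QPS']]]]]] := complex_splitting GG.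
under eq_bigr => i _ do rewrite hE hG.
rewrite -/(tensor_rank h h' n).
pose LP (u : family k h h') : family k f g := fun i j => (P i)^T *m u i j *m P' j.
pose LQ (v : family k f g) : family k h h' := fun i j => (Q i)^T *m v i j *m Q' j.
have LPlin : fam_lin LP.
  by move=> a u v i j; rewrite /LP mulmxDr mulmxDl -scalemxAr -scalemxAl.
have LQlin : fam_lin LQ.
  by move=> a u v i j; rewrite /LQ mulmxDr mulmxDl -scalemxAr -scalemxAl.
have Dlin : fam_lin (tdiff E G) by exact: tdiff_lin.
have LPD u i j : tdiff E G (LP u) i j = 0.
  rewrite /tdiff /LP !mulmxA -trmx_mul PE trmx0 !mul0mx add0r.
  by rewrite -!mulmxA PG !mulmx0 scaler0.
have LDQ v i j : LQ (tdiff E G v) i j = 0.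
  rewrite /tdiff /LQ mulmxDr mulmxDl !mulmxA -trmx_mul EQ trmx0 !mul0mx add0r.
  by rewrite -scalemxAr -scalemxAl -!mulmxA GQ !mulmx0 scaler0.
apply: (@hdim_unique _ _ _ _ _ _ (fam_mx n n LP) (fam_mx n n LQ)).
- move=> m; apply: fam_mxP => w i j ij.
  rewrite mulmx0 unpack0 mulmxA !mul_fam_mx // packK //.
  rewrite -(tdiff_complex EE GG (unpack w) i j).
  by apply: eq_tdiff ij => i' j' ij'; rewrite packK.
- case: n => [|n]; first exact: submx1.
  apply/sub_kermxP; apply: fam_mxP => w i j ij.
  rewrite mulmx0 unpack0 mulmxA !mul_fam_mx // packK //.
  rewrite -(LPD (unpack w) i j).
  by apply: eq_tdiff ij => i' j' ij'; rewrite packK.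
- apply: fam_mxP => w i j ij; rewrite mulmx0 unpack0 mulmxA !mul_fam_mx // packK //.
  by rewrite /LQ packK // -/(LQ (tdiff E G (unpack w)) i j) LDQ.
- apply: fam_mxP => w i j ij; rewrite mulmx1 mulmxA !mul_fam_mx // packK //.
  rewrite /LQ packK // /LP !mulmxA -trmx_mul PQ trmx1 mul1mx.
  by rewrite -!mulmxA PQ' mulmx1.
move=> v vcyc vQ; apply/submxP.
have vcyc' i j : (i + j).+1 = n -> tdiff E G (unpack v) i j = 0.
  case: n v vcyc {vQ} => // n v /sub_kermxP vD [ij].
  by rewrite -(packK _ ij) -mul_fam_mx // [_ *m _]vD unpack0.
have vQ' i j : (i + j)%N = n -> (Q i)^T *m unpack v i j *m Q' j = 0.
  by move=> ij; rewrite -/(LQ (unpack v) i j) -(packK _ ij) -mul_fam_mx // vQ unpack0.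
exists (pack n.+1 (tensor_htpy P Q s s' (unpack v))).
rewrite mul_fam_mx //; apply: unpackP => i j ij.
rewrite packK // (tensor_htpyP PE EQ QP0 QPS QP0' QPS' vcyc' vQ' ij).
by apply: eq_tdiff ij => i' j' ij'; rewrite packK.
Qed.

End Kunneth.

Section SingleEntry.
Variables (R : comNzRingType) (f g : nat -> nat).

Definition entry a b (u : 'M[R]_(f a, g b)) : family R f g :=
  fun i j => if (i == a) && (j == b) then conform_mx 0 u else 0.

Lemma entry_id a b (u : 'M[R]_(f a, g b)) : entry u a b = u.
Proof. by rewrite /entry !eqxx conform_mx_id. Qed.

Lemma entry_ne a b (u : 'M[R]_(f a, g b)) i j : i != a -> entry u i j = 0.
Proof. by rewrite /entry => /negPf ->. Qed.

End SingleEntry.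

(** * Algebra retracts *)

Section Retract.
Variables (R S : comNzRingType) (k : fieldType).
Variables (pi : {rmorphism R -> S}) (sig : {rmorphism S -> R}).
Variables (eps : {rmorphism R -> k}) (epsS : {rmorphism S -> k}).
Hypothesis sigK : forall x, pi (sig x) = x.
Hypothesis epsE : forall x, epsS (pi x) = eps x.

Let pi_onto y : exists x, pi x = y. Proof. by exists (sig y). Qed.

Section Total.
Variables (f g : nat -> nat).
Variables (dF : forall i, 'M[S]_(f i.+1, f i)) (cF : 'cV[k]_(f 0%N)).
Variables (dG : forall i, 'M[R]_(g i.+1, g i)) (cG : 'cV[S]_(g 0%N)).
Hypotheses (Fres : is_resolution epsS dF cF) (Gres : is_resolution pi dG cG).

Local Notation FR := (fun i => map_mx sig (dF i)).
Local Notation D := (tdiff FR dG).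

Let FF i : FR i.+1 *m FR i = 0.
Proof. by rewrite -map_mxM (res_complex Fres) map_mx0. Qed.

Let GG i : dG i.+1 *m dG i = 0. Proof. exact: res_complex Gres i. Qed.

Let pi_sig m n (A : 'M[S]_(m, n)) : map_mx pi (map_mx sig A) = A.
Proof. by apply/matrixP => i j; rewrite !mxE sigK. Qed.

(** The image in F of the component of a family in F_N (x) G_0. *)
Let aug N (v : family R f g) : 'cV[S]_(f N) := map_mx pi (v N 0%N) *m cG.

(** One step of the zigzag: the component of v in F_m (x) G_(N-m) is cleared,
   using exactness of G, or of F when m = N. *)
Let clear_entry N m (v : family R f g) : (m <= N)%N ->
    (forall i j, (i + j).+1 = N -> D v i j = 0) ->
    (forall i j, (i + j)%N = N -> (m < i)%N -> v i j = 0) ->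
    (m = N -> exists w, (aug N v)^T = w *m dF N) ->
  exists w, (forall i j, (i + j)%N = N -> (m < i)%N -> D w i j = 0) /\
    forall j, (m + j)%N = N -> D w m j = v m j.
Proof.
move=> leN vcyc v0 vaug; case: (ltngtP m N) leN => // [ltN|eN] _; last first.
  have [w wE] := vaug eN; subst m.
  have [u uE] := res_aug_lift_mx pi_onto Gres w^T.
  have [|y yE] := res_exact_aug_mx Gres (A := v N 0%N - (FR N)^T *m u).
    rewrite map_mxB map_mxM map_trmx pi_sig mulmxBl -mulmxA uE -/(aug N v).
    by rewrite -trmx_mul -wE trmxK subrr.
  exists (fun i j => entry u i j + entry ((-1) ^+ N *: y : 'M_(f N, g 1%N)) i j).
  split=> [i j|j]; first by move=> e lti; exfalso; lia.
  rewrite -{2}[N]addn0 => /addnI ->; rewrite /tdiff !entry_id.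
  rewrite [entry _ N.+1 _]entry_ne ?gtn_eqF // [entry u N _]entry_ne ?ltn_eqF //.
  rewrite addr0 add0r -scalemxAl scalerA -exprD addnn -signr_odd odd_double scale1r.
  by rewrite -yE addrC subrK.
pose j := (N - m).-1; have jN : (m + j).+1 = N by rewrite /j; lia.
have [|u uE] := res_exact_mx Gres (A := v m j.+1).
  have := vcyc m j jN; rewrite /tdiff v0 ?mulmx0 ?add0r //.
  by move=> /(congr1 ( *:%R ((-1) ^+ m))); rewrite scaler0 scalerA -exprD addnn
    -signr_odd odd_double scale1r.
exists (entry ((-1) ^+ m *: u : 'M_(f m, g j.+2))); split=> [i j' _ lti|j'].
  by rewrite /tdiff !entry_ne ?mulmx0 ?mul0mx ?scaler0 ?addr0 // gtn_eqF // ltnW.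
rewrite -jN -addnS => /addnI ->; rewrite /tdiff entry_id entry_ne ?gtn_eqF //.
rewrite mulmx0 add0r.
by rewrite -scalemxAl scalerA -exprD addnn -signr_odd odd_double scale1r.
Qed.

(** The components of a cycle are cleared one after the other, by descending
    degree in F. *)
Let tensor_exact N (v : family R f g) :
    (forall i j, (i + j).+1 = N -> D v i j = 0) ->
    (exists w, (aug N v)^T = w *m dF N) ->
  exists w, forall i j, (i + j)%N = N -> v i j = D w i j.
Proof.
move=> vcyc vaug.
suff H m : (m <= N.+1)%N -> forall v,
    (forall i j, (i + j).+1 = N -> D v i j = 0) ->
    (forall i j, (i + j)%N = N -> (m <= i)%N -> v i j = 0) ->
    (m = N.+1 -> exists w, (aug N v)^T = w *m dF N) ->
    exists w, forall i j, (i + j)%N = N -> v i j = D w i j.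
  apply: (H N.+1) => // i j <-; by rewrite ltnNge leq_addr.
elim: m => [|m IH] leN {vcyc vaug}v vcyc v0 vaug.
  by exists (fun i j => 0) => i j ijN; rewrite v0 // /tdiff mulmx0 mul0mx scaler0 addr0.
have [|w [w0 wv]] := clear_entry (leN : (m <= N)%N) vcyc v0 _.
  by move=> e; apply: vaug; rewrite e.
have [||||w' w'E] := IH _ (fun i j => v i j - D w i j).
- exact: ltnW.
- by move=> i j ij; rewrite tdiffB vcyc // tdiff_complex // subrr.
- move=> i j ijN; rewrite leq_eqVlt => /orP[/eqP e|lti].
    by subst i; rewrite wv // subrr.
  by rewrite v0 // w0 // subrr.
- by move=> e; move: leN; rewrite e ltnn.
exists (fun i j => w' i j + w i j) => i j ijN.
by rewrite tdiffD -w'E // subrK.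
Qed.

Definition total_diff n := fam_mx n.+1 n D.

Let aug_row (w : 'rV[k]_(tensor_rank f g 0)) : 'rV[k]_1 :=
  cF^T *m (unpack w 0%N 0%N *m map_mx epsS cG).

Let aug_row_linear : linear aug_row.
Proof.
move=> a u v; rewrite /aug_row unpack_linear mulmxDl mulmxDr.
by rewrite -scalemxAl -scalemxAr.
Qed.

Definition total_aug : 'cV[k]_(tensor_rank f g 0) := lin1_mx aug_row.

Let mul_total_aug w : w *m total_aug = aug_row w.
Proof.
pose L : {linear _ -> _} := HB.pack aug_row (GRing.isLinear.Build k
  'rV[k]_(tensor_rank f g 0) 'rV[k]_1 _ _ aug_row_linear).
exact: (mul_rV_lin1 L).
Qed.

Let epsmx m n (A : 'M[R]_(m, n)) : map_mx eps A = map_mx epsS (map_mx pi A).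
Proof. by apply/matrixP => i j; rewrite !mxE epsE. Qed.

Let aug_rowE (w : 'rV[R]_(tensor_rank f g 0)) :
  map_mx eps w *m total_aug = (map_mx epsS (aug 0 (unpack w))^T *m cF)^T.
Proof.
by rewrite mul_total_aug /aug_row unpack_map epsmx -map_mxM -/(aug 0 _)
  trmx_mul -map_trmx trmxK.
Qed.

(** The columns G of the double complex resolve the modules of F, viewed over S,
    so that the total complex has the homology of F. *)
Lemma total_resolution : is_resolution eps total_diff total_aug.
Proof.
have Dlin : fam_lin D by exact: tdiff_lin.
have [[u uP] exF0 _] := Fres; split.
- have [A AE] := res_aug_lift_mx pi_onto Gres u^T.
  exists (pack 0 (entry A)); rewrite aug_rowE.
  rewrite /aug packK // entry_id AE trmxK uP; exact: trmx1.
- move=> v; rewrite aug_rowE; split=> [|[w ->]].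
    move=> /(congr1 trmx); rewrite trmxK trmx0 => /exF0 vaug.
    have [|w wE] := tensor_exact _ vaug; first by [].
    exists (pack 1 w); rewrite mul_fam_mx //; apply: unpackP => i j ij.
    by rewrite packK // wE //; apply: eq_tdiff ij => i' j' ij'; rewrite packK.
  apply: (canLR trmxK); rewrite trmx0; apply/exF0.
  exists (aug 1 (unpack w))^T; apply: trmx_inj.
  rewrite trmxK [RHS]trmx_mul trmxK /aug mul_fam_mx // packK // /tdiff.
  rewrite map_mxD map_mxZ !map_mxM.
  rewrite mulmxDl map_trmx pi_sig -scalemxAl -[_ *m map_mx pi (dG 0%N) *m _]mulmxA.
  by rewrite (res_complex_aug Gres) mulmx0 scaler0 addr0 mulmxA.
move=> n v; split=> [vD|[w ->]]; last first.
  rewrite -mulmxA; suff -> : total_diff n.+1 *m total_diff n = 0 by rewrite mulmx0.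
  apply: fam_mxP => {}w i j ij; rewrite mulmx0 mulmxA !mul_fam_mx // packK //.
  rewrite unpack0.
  rewrite -[RHS](tdiff_complex FF GG (unpack w) i j).
  by apply: eq_tdiff ij => i' j' ij'; rewrite packK.
have vcyc i j : (i + j).+1 = n.+1 -> D (unpack v) i j = 0.
  move=> [ij]; rewrite -(packK _ ij) -mul_fam_mx // [_ *m _]vD.
  exact: unpack0.
have [|w wE] := tensor_exact vcyc; last first.
  exists (pack n.+2 w); rewrite mul_fam_mx //; apply: unpackP => i j ij.
  by rewrite packK // wE //; apply: eq_tdiff ij => i' j' ij'; rewrite packK.
case: Fres => _ _ exF; apply/exF; apply: trmx_inj.
have := vcyc n 0%N; rewrite addn0 => /(_ erefl).
move=> /(congr1 (fun A => map_mx pi A *m cG)).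
rewrite /tdiff map_mxD map_mxZ !map_mxM mulmxDl map_trmx pi_sig -scalemxAl.
rewrite -[_ *m map_mx pi (dG 0%N) *m _]mulmxA (res_complex_aug Gres).
rewrite mulmx0 scaler0 addr0.
by rewrite map_mx0 mul0mx -mulmxA trmx0 trmx_mul trmxK.
Qed.

End Total.
End Retract.

(** The series of the dimensions of Tor^R(S, k), when d resolves S over R. *)
Definition tor_series (R : comNzRingType) (k : fieldType) (eps : {rmorphism R -> k})
    (g : nat -> nat) (d : forall i, 'M[R]_(g i.+1, g i)) : fps rat :=
  FPS (fun n => (hdim (fun i => map_mx eps (d i)) n)%:R).

Section RetractPoincare.
Variables (R S : comNzRingType) (k : fieldType).
Variables (pi : {rmorphism R -> S}) (sig : {rmorphism S -> R}).
Variables (eps : {rmorphism R -> k}) (epsS : {rmorphism S -> k}).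
Hypothesis sigK : forall x, pi (sig x) = x.
Hypothesis epsE : forall x, epsS (pi x) = eps x.
Hypothesis eps_onto : forall y, exists x, eps x = y.

(** The total complex, reduced modulo the augmentation ideal, is the tensor
    product of the reductions of F and G, because sig maps the augmentation ideal
    of S into that of R. *)
Theorem poincare_retract (g : nat -> nat) (d : forall i, 'M[R]_(g i.+1, g i)) c :
    noetherian S -> is_resolution pi d c ->
  poincare_of eps = poincare_of epsS * tor_series eps d.
Proof.
move=> noeS dres; have [f [dF [cF Fres]]] := resolution_exists epsS noeS.
have epsS_onto y : exists x, epsS x = y by have [x <-] := eps_onto y; exists (pi x).
have epsmx m n (A : 'M[S]_(m, n)) : map_mx eps (map_mx sig A) = map_mx epsS A.
  by apply/matrixP => i j; rewrite !mxE -epsE sigK.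
apply: fpsP => n; rewrite fps_coefM.
rewrite (poincare_ofE eps_onto (total_resolution sigK epsE Fres dres)).
have -> : hdim (fun n => map_mx eps (total_diff sig dF d n)) n =
    hdim (fun n => fam_mx n.+1 n
      (tdiff (fun i => map_mx epsS (dF i)) (fun i => map_mx eps (d i)))) n.
  congr (hdim _ n); apply: functional_extensionality_dep => i.
  apply: map_fam_mx => v a b; rewrite /tdiff map_mxD map_mxZ !map_mxM map_trmx epsmx.
  by rewrite rmorphXn rmorphN1 !map_trmx.
rewrite kunneth; first 1 last.
- by move=> i; rewrite -map_mxM (res_complex Fres) map_mx0.
- by move=> i; rewrite -map_mxM (res_complex dres) map_mx0.
rewrite natr_sum; apply: eq_bigr => i _.
by rewrite natrM (poincare_ofE epsS_onto Fres).
Qed.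

End RetractPoincare.

Section Deletion.
Variables (R S Q : comNzRingType) (k : fieldType) (x : R).
Variables (piS : {rmorphism R -> S}) (sigS : {rmorphism S -> R}).
Variables (piQ : {rmorphism R -> Q}) (sigQ : {rmorphism Q -> R}).
Variables (eps : {rmorphism R -> k}) (epsS : {rmorphism S -> k}).
Variables (epsQ : {rmorphism Q -> k}).
Hypotheses (sigSK : forall y, piS (sigS y) = y) (sigQK : forall y, piQ (sigQ y) = y).
Hypothesis (epsSE : forall y, epsS (piS y) = eps y).
Hypothesis (epsQE : forall y, epsQ (piQ y) = eps y).
Hypothesis eps_onto : forall y, exists z, eps z = y.
Hypothesis eps_x : eps x = 0.
Hypothesis kerS : forall y, piS y = 0 <-> exists z, y = z * x.
Hypothesis kerQ : forall y, piQ y = 0 <-> y * x = 0.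

(** Since xR is isomorphic to Q = R/(0 : x), a resolution of Q continues a
    resolution of S = R/xR, and both P_R = P_S * (1 + t T) and P_R = P_Q * T, where
    T is the series of Tor^R(Q, k). *)
Theorem poincare_deletion : noetherian R -> noetherian S -> noetherian Q ->
  poincare_of eps * (poincare_of epsQ - fpsX * poincare_of epsS) =
  poincare_of epsS * poincare_of epsQ.
Proof.
move=> noeR noeS noeQ; have [e [d [c dres]]] := resolution_exists piQ noeR.
pose g i := match i with 0%N => 1%N | j.+1 => e j end.
pose d' i : 'M[R]_(g i.+1, g i) :=
  match i with 0%N => x *: map_mx sigQ c | j.+1 => d j end.
have mulc (v : 'rV_(e 0%N)) : v *m d' 0%N = 0 <-> map_mx piQ v *m c = 0.
  have cE : c = map_mx piQ (map_mx sigQ c) by apply/matrixP => i j; rewrite !mxE sigQK.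
  rewrite /= -scalemxAr {2}cE -map_mxM; split=> /matrixP/(_ 0 0) e0.
    apply/matrixP => i j; rewrite !ord1 mxE; rewrite [RHS]mxE; apply/kerQ.
    by rewrite mulrC; move: e0; rewrite mxE [RHS]mxE.
  apply/matrixP => i j; rewrite !ord1 mxE [RHS]mxE mulrC; apply/kerQ.
  by move: e0; rewrite mxE [RHS]mxE.
have dres' : is_resolution piS d' (1%:M : 'cV_1).
  have [[u uc] ex0 ex] := dres; split.
  - by exists 1%:M; rewrite map_mx1 mulmx1.
  - move=> v; rewrite mulmx1; split=> [|[w ->]].
      move=> /matrixP/(_ 0 0); rewrite !mxE => /kerS[z vz].
      exists (z *: u); rewrite -scalemxAl /= -scalemxAr.
      apply/matrixP => i j; rewrite !ord1 vz mxE; congr (z * _).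
      rewrite mxE; apply/eqP; rewrite eq_sym -subr_eq0 -{2}[x]mulr1 -mulrBr mulrC.
      apply/eqP/kerQ; rewrite rmorphB rmorph1; apply/eqP; rewrite subr_eq0; apply/eqP.
      have := uc; rewrite -{1}(_ : map_mx piQ (map_mx sigQ c) = c); last first.
        by apply/matrixP => a b; rewrite !mxE sigQK.
      by rewrite -map_mxM => /matrixP/(_ 0 0); rewrite mxE [RHS]mxE.
    apply/matrixP => i j; rewrite /= -scalemxAr mxE [RHS]mxE; apply/kerS.
    by rewrite mxE; exists ((w *m map_mx sigQ c) i j); rewrite mulrC.
  - by case=> [|i] v; [rewrite mulc; exact: ex0|exact: ex].
have E := poincare_retract sigQK epsQE eps_onto noeQ dres.
have E' := poincare_retract sigSK epsSE eps_onto noeS dres'.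
have tE : tor_series eps d' = 1 + fpsX * tor_series eps d.
  have d'0 : map_mx eps (d' 0%N) = 0 by rewrite map_mxZ eps_x scale0r.
  apply: fpsP => n; rewrite fps_coefD fps_coef1 fps_coefXM /=.
  case: n => [|[|n]]; rewrite !hdim_diff ?d'0 ?mxrank0 ?subn0 /= ?addr0 ?add0r //.
set p := poincare_of eps in E E' *.
set q := poincare_of epsQ in E *; set r := poincare_of epsS in E' *.
rewrite mulrBr {1}E' tE E; ring.
Qed.

End Deletion.

(** * Hypergraph algebras *)

Section Algebra.
Variables (k : fieldType) (N : nat) (H : hypergraph N).
Local Notation A := (hypergraph_algebra k H).

Definition hproj : {rmorphism {mpoly k[N]} -> A} := (\pi_A)%qT.

Definition hX (i : 'I_N) : A := hproj 'X_i.
Definition hC : {rmorphism k -> A} := hproj \o @mpolyC N k.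

Lemma hproj_onto a : exists p, hproj p = a.
Proof. by exists (repr a); rewrite /hproj /= reprK. Qed.

Lemma hproj_eq0 p : (hproj p == 0) = (p \in edge_ideal (k := k) H).
Proof. by rewrite -(rmorph0 hproj) -Quotient.idealrBE subr0. Qed.

Lemma hg_aug_proj p : hg_aug (hproj p) = p.@[fun=> 0].
Proof. exact: hg_aug_pi. Qed.

Lemma hg_augC c : hg_aug (hC c) = c.
Proof. by rewrite hg_aug_proj mevalC. Qed.

Lemma hg_augX i : hg_aug (hX i) = 0.
Proof. by rewrite hg_aug_proj mevalXU. Qed.

Lemma hg_aug_onto c : exists a : A, hg_aug a = c.
Proof. by exists (hC c); rewrite hg_augC. Qed.

Lemma noetherian_hypergraph : noetherian A.
Proof. exact: noetherian_quotient hproj_onto (@noetherian_mpoly k N). Qed.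

Lemma hg_ind (P : A -> Prop) :
    (forall c, P (hC c)) -> (forall i, P (hX i)) ->
    (forall a b, P a -> P b -> P (a + b)) -> (forall a b, P a -> P b -> P (a * b)) ->
  forall a, P a.
Proof.
move=> PC PX PD PM a; have [p <-] := hproj_onto a.
elim/mpoly_closed_ind: p => [//|//|p q Pp Pq|p q Pp Pq].
  by rewrite rmorphD; apply: PD.
by rewrite rmorphM; apply: PM.
Qed.

Lemma hg_ext (S : comNzRingType) (phi psi : {rmorphism A -> S}) :
    (forall c, phi (hC c) = psi (hC c)) -> (forall i, phi (hX i) = psi (hX i)) ->
  forall a, phi a = psi a.
Proof.
by move=> eC eX; apply: hg_ind => // a b ea eb; rewrite ?rmorphD ?rmorphM ea eb.
Qed.

Lemma hproj_edge (e : {set 'I_N}) : hproj (edge_monomial k e) = \prod_(i in e) hX i.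
Proof. exact: rmorph_prod. Qed.

Lemma edge_in_ideal e : e \in edges H -> edge_monomial k e \in edge_ideal (k := k) H.
Proof.
move=> eH; apply/edge_idealP; exists (fun e' => (e' == e)%:R).
rewrite (bigD1 e) //= eqxx mul1r big1 ?addr0 // => e' /andP[_ /negPf ->].
by rewrite mul0r.
Qed.

Lemma hX_edge (e e' : {set 'I_N}) : e \in edges H -> e \subset e' ->
  \prod_(i in e') hX i = 0.
Proof.
move=> eH /setIidPr ee'; rewrite (big_setID e) /= ee' -hproj_edge.
by move/edge_in_ideal: eH; rewrite -hproj_eq0 => /eqP ->; rewrite mul0r.
Qed.

Lemma hX_vertex i : [set i] \in edges H -> hX i = 0.
Proof. by move=> /hX_edge/(_ (subxx _)); rewrite big_set1. Qed.

Lemma hlift (V : zmodType) (phi : {additive {mpoly k[N]} -> V}) :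
    (forall p, p \in edge_ideal (k := k) H -> phi p = 0) ->
  exists psi : {additive A -> V}, forall p, psi (hproj p) = phi p.
Proof.
move=> phi0; pose psi (a : A) := phi (repr a).
have psiE p : psi (hproj p) = phi p.
  apply/eqP; rewrite -subr_eq0 -raddfB; apply/eqP/phi0.
  by rewrite -hproj_eq0 rmorphB subr_eq0 /hproj /= reprK.
have psiB : zmod_morphism psi.
  move=> a b; have [p <-] := hproj_onto a; have [q <-] := hproj_onto b.
  by rewrite -rmorphB !psiE raddfB.
pose Psi : {additive A -> V} := HB.pack psi (GRing.isZmodMorphism.Build A V psi psiB).
by exists Psi.
Qed.

Lemma hg_univ (S : comNzRingType) (alpha : {rmorphism k -> S}) (x : 'I_N -> S) :
    (forall e, e \in edges H -> \prod_(i in e) x i = 0) ->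
  exists psi : {rmorphism A -> S},
    (forall c, psi (hC c) = alpha c) /\ forall i, psi (hX i) = x i.
Proof.
move=> x0; pose phi : {rmorphism {mpoly k[N]} -> S} := mmap alpha x.
have phi0 p : p \in edge_ideal (k := k) H -> phi p = 0.
  case/edge_idealP=> c ->; rewrite rmorph_sum big1 // => e /x0 xe.
  rewrite rmorphM rmorph_prod /= (eq_bigr x) ?xe ?mulr0 // => i _.
  by rewrite mmapX mmap1U.
have [psi psi_phi] := @hlift S phi phi0.
have psiE p : psi (hproj p) = phi p := psi_phi p.
have psiM : monoid_morphism psi.
  split; first by rewrite -(rmorph1 hproj) psiE rmorph1.
  move=> a b; have [p <-] := hproj_onto a; have [q <-] := hproj_onto b.
  by rewrite -rmorphM !psiE rmorphM.
pose Psi : {rmorphism A -> S} := HB.pack (psi : A -> S)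
  (GRing.isZmodMorphism.Build A S psi (raddfB psi))
  (GRing.isMonoidMorphism.Build A S psi psiM).
exists Psi; split=> [c|i] /=.
  by rewrite psiE /phi /= mmapC.
by rewrite psiE /phi /= mmapX mmap1U.
Qed.

Definition mset (m : 'X_{1..N}) : {set 'I_N} := [set i | m i != 0%N].

Definition covered (m : 'X_{1..N}) := [exists e in edges H, e \subset mset m].

Lemma edge_monomialE (e : {set 'I_N}) :
  edge_monomial k e = 'X_[\sum_(i in e) U_(i)].
Proof. by rewrite /edge_monomial mprodXE. Qed.

Lemma mset_sub (e : {set 'I_N}) m :
  (e \subset mset m) = (\sum_(i in e) U_(i) <= m)%MM.
Proof.
have eE j : (\sum_(i in e) U_(i))%MM j = (j \in e).
  rewrite mnm_sumE; have [je|je] := boolP (j \in e).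
    rewrite (bigD1 j) //= mnm1E eqxx big1 // => i /andP[_ /negPf ij].
    by rewrite mnm1E ij.
  by rewrite big1 // => i ie; rewrite mnm1E; case: eqP => // ij; rewrite -ij ie in je.
apply/subsetP/mnm_lepP => [em i|em i ie].
  by rewrite eE; case: (boolP (i \in e)) => // /em; rewrite inE lt0n.
by have := em i; rewrite eE ie inE lt0n.
Qed.

(** Membership in a monomial ideal is decided term by term. *)
Lemma mem_edge_ideal p :
  reflect (forall m, m \in msupp p -> covered m) (p \in edge_ideal (k := k) H).
Proof.
apply: (iffP idP) => [/edge_idealP[c ->] m|pcov].
  move=> /msupp_sum_le /flattenP[s /mapP[e]].
  rewrite mem_filter => /andP[eH _] ->; rewrite edge_monomialE => ms.
  apply/existsP; exists e; rewrite eH mset_sub /=.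
  have := perm_mem (msuppMX (c e) (\sum_(i in e) U_(i))%MM) m.
  rewrite ms => /esym/mapP[m' _ ->]; exact: lem_addr.
rewrite (mpolyE p) big_seq; elim/big_rec: _ => [|m q mp qI]; first exact: rpred0.
apply: rpredD => //; have /existsP[e /andP[eH em]] := pcov m mp.
rewrite mset_sub in em; rewrite -(submK em) mpolyXD scalerAl.
apply: idealMr; rewrite -edge_monomialE; exact: edge_in_ideal.
Qed.

Lemma hproj_eq0P p : hproj p = 0 <-> forall m, m \in msupp p -> covered m.
Proof.
by split=> [/eqP|]; [rewrite hproj_eq0 => /mem_edge_ideal|
  move=> /mem_edge_ideal; rewrite -hproj_eq0 => /eqP].
Qed.

End Algebra.

Lemma poincare_iso (R S : comNzRingType) (k : fieldType)
    (phi : {rmorphism R -> S}) (psi : {rmorphism S -> R})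
    (eps : {rmorphism R -> k}) (epsS : {rmorphism S -> k}) :
    cancel phi psi -> cancel psi phi -> (forall x, epsS (phi x) = eps x) ->
    (forall y, exists x, eps x = y) -> noetherian S ->
  poincare_of eps = poincare_of epsS.
Proof.
move=> phiK psiK epsE eps_onto noeS.
have phi_inj x : phi x = 0 -> x = 0 by move=> x0; rewrite -(phiK x) x0 rmorph0.
rewrite (poincare_retract psiK epsE eps_onto noeS (trivial_resolution phi_inj)).
rewrite -[RHS]mulr1; congr (_ * _).
by apply: fpsP => n /=; rewrite hdim_trivial.
Qed.

Section Hom.
Variables (k : fieldType) (N N' : nat) (H : hypergraph N) (H' : hypergraph N').

Lemma hg_hom (x : 'I_N -> hypergraph_algebra k H') :
    (forall e, e \in edges H -> \prod_(i in e) x i = 0) ->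
  exists psi : {rmorphism hypergraph_algebra k H -> hypergraph_algebra k H'},
    (forall c, psi (hC k H c) = hC k H' c) /\ forall i, psi (hX k H i) = x i.
Proof. exact: hg_univ. Qed.

Lemma hg_aug_hom (psi : {rmorphism hypergraph_algebra k H -> hypergraph_algebra k H'}) :
    (forall c, psi (hC k H c) = hC k H' c) ->
    (forall i, hg_aug (psi (hX k H i)) = 0) ->
  forall a, hg_aug (psi a) = hg_aug a.
Proof.
move=> psiC psiX; apply: hg_ind => [c|i|a b ea eb|a b ea eb].
- by rewrite psiC !hg_augC.
- by rewrite psiX hg_augX.
- by rewrite !rmorphD /= ea eb.
- by rewrite !rmorphM /= ea eb.
Qed.

End Hom.

Section Congruence.
Variables (k : fieldType) (N : nat) (H : hypergraph N).
Local Notation A := (hypergraph_algebra k H).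

Lemma hg_endo_mod (phi : A -> A) (f : A) :
    (forall c, phi (hC k H c) = hC k H c) -> {morph phi : a b / a + b} ->
    {morph phi : a b / a * b} ->
    (forall i, exists y, hX k H i - phi (hX k H i) = f * y) ->
  forall a, exists y, a - phi a = f * y.
Proof.
move=> phiC phiD phiM phiX; apply: hg_ind => [c|//|a b [y ay] [z bz]|a b [y ay] [z bz]].
- by exists 0; rewrite phiC subrr mulr0.
- by exists (y + z); rewrite phiD opprD addrACA ay bz mulrDr.
- exists (y * b + phi a * z).
  have -> : a * b - phi (a * b) = (a - phi a) * b + phi a * (b - phi b).
    by rewrite phiM; ring.
  by rewrite ay bz; ring.
Qed.

(** The coefficient of the variable y, as a derivation; it vanishes on the ideal
    unless y does. *)
Lemma hg_del y : [set y] \notin edges H ->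
  exists del : {additive A -> k},
    (forall a b, del (a * b) = hg_aug a * del b + del a * hg_aug b) /\
    forall i, del (hX k H i) = (i == y)%:R.
Proof.
move=> yH; have [p /mem_edge_ideal pI|del delE] := @hlift k N H k (@mcoeff N k U_(y)).
  apply/eqP; rewrite mcoeff_eq0; apply/negP => /pI/existsP[e /andP[eH ey]].
  case/negP: yH; suff <- : e = [set y] by [].
  have : e \subset [set y].
    apply: subset_trans ey _; apply/subsetP => i.
    by rewrite !inE mnm1E eqb0 negbK eq_sym.
  rewrite subset1 => /orP[/eqP //|/eqP e0].
  by have := edges_neq0 H; rewrite -e0 eH.
have meval0 (p : {mpoly k[N]}) : p.@[fun=> 0] = p@_0%MM.
  elim/mpoly_closed_ind: p => [c|i|p q ep eq|p q ep eq].
  - by rewrite mevalC mcoeffC eqxx mulr1.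
  - by rewrite mevalXU mcoeffX mnm1_eq0.
  - by rewrite mevalD mcoeffD ep eq.
  - by rewrite mevalM rmorphM ep eq.
exists del; split=> [a b|i]; last by rewrite delE /= mcoeffX eq_mnm1.
have [p <-] := hproj_onto a; have [q <-] := hproj_onto b.
rewrite -rmorphM !delE /= !hg_aug_proj !meval0.
have dE (r : {mpoly k[N]}) : r@_U_(y) = (r^`M(y))@_0%MM.
  by rewrite mcoeff_deriv add0m mnm0E mulr1n.
by rewrite !dE mderivM mcoeffD !rmorphM addrC.
Qed.

End Congruence.

(** * Deletion and renumbering of vertices *)

Section Operations.
Variable k : fieldType.

Lemma hg_hom_onto N N' (H : hypergraph N) (H' : hypergraph N')
    (psi : {rmorphism hypergraph_algebra k H -> hypergraph_algebra k H'}) :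
    (forall c, psi (hC k H c) = hC k H' c) ->
    (forall i, exists a, psi a = hX k H' i) ->
  forall b, exists a, psi a = b.
Proof.
move=> psiC psiX; apply: hg_ind => [c|//|a b [x <-] [y <-]|a b [x <-] [y <-]].
- by exists (hC k H c).
- by exists (x + y); rewrite rmorphD.
- by exists (x * y); rewrite rmorphM.
Qed.

Lemma mset_add N (m : 'X_{1..N}) i : mset (U_(i) + m)%MM = i |: mset m.
Proof.
apply/setP => j; rewrite !inE mnmDE mnm1E (eq_sym i).
by case: (j == i); rewrite ?add0n.
Qed.

Lemma mulX_eq0 N (H : hypergraph N) w p :
  hX k H w * hproj k H p = 0 <-> forall m, m \in msupp p -> covered H (U_(w) + m)%MM.
Proof.
rewrite /hX -rmorphM mulrC hproj_eq0P; split=> cov m mp.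
  apply: cov; rewrite (perm_mem (msuppMX _ _)); apply/mapP; by exists m.
by move: mp; rewrite (perm_mem (msuppMX _ _)) => /mapP[m' /cov ? ->].
Qed.

(** A vertex w outside all edges is a polynomial variable; in the algebra of H'
    it is set to zero, that is, the vertex is killed by the edge [set w]. *)
Lemma poincare_free_vertex N (H H' : hypergraph N) w :
    (forall e, e \in edges H -> w \notin e) -> edges H' = [set w] |: edges H ->
  poincare k H = (1 + fpsX) * poincare k H'.
Proof.
move=> Hw H'E.
have [|pi [piC piX]] := @hg_hom k N N H H' (hX k H').
  by move=> e eH; apply: hX_edge (subxx _); rewrite H'E !inE eH orbT.
have [|sig [sigC sigX]] := @hg_hom k N N H' H (fun i => if i == w then 0 else hX k H i).
  move=> e; rewrite H'E !inE => /orP[/eqP ->|eH]; first by rewrite big_set1 eqxx.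
  rewrite (eq_bigr (hX k H)) ?(hX_edge _ eH) // => i ie.
  by case: eqP => // iw; have := Hw e eH; rewrite -iw ie.
have [|del [delM delX]] := @hg_del k N H w.
  by apply/negP => /Hw; rewrite set11.
have w0 : hX k H' w = 0 by apply: hX_vertex; rewrite H'E !inE eqxx.
apply: (@poincare_regular_element _ _ k pi _ _ _ _ _ (hX k H w) _ _ del) => //.
- by apply: hg_hom_onto => // i; exists (hX k H i).
- exact: hg_aug_onto.
- by apply: hg_aug_hom => // i; rewrite piX hg_augX.
- move=> a; have [p <-] := hproj_onto a; rewrite mulX_eq0 hproj_eq0P => cov m /cov.
  rewrite /covered => /existsP[e /andP[eH]]; rewrite mset_add => /subsetP em.
  apply/existsP; exists e; rewrite eH /=; apply/subsetP => i ie.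
  by have := em i ie; rewrite !inE => /orP[/eqP iw|//]; have := Hw e eH; rewrite -iw ie.
- move=> a; split=> [pia|[y ->]]; last by rewrite rmorphM piX w0 mul0r.
  have [||||y] := @hg_endo_mod k N H (sig \o pi) (hX k H w) _ _ _ _ a.
  + by move=> c; rewrite /= piC sigC.
  + by move=> x y; rewrite rmorphD.
  + by move=> x y; rewrite rmorphM.
  + move=> i; rewrite /= piX sigX; case: eqP => [->|_].
      by exists 1; rewrite subr0 mulr1.
    by exists 0; rewrite subrr mulr0.
  by rewrite /= pia rmorph0 subr0 => ->; exists y.
- by rewrite delX eqxx.
- exact: noetherian_hypergraph.
Qed.

(** The variables outside the image of u vanish in the algebra of H, so that u
    and its partial inverse define inverse isomorphisms. *)
Lemma poincare_embedding N N' (H : hypergraph N) (H' : hypergraph N')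
    (u : 'I_N' -> 'I_N) :
    injective u ->
    (forall i, i \notin codom u -> [set i] \in edges H) ->
    (forall e', e' \in edges H' -> exists2 e, e \in edges H & e \subset u @: e') ->
    (forall e, e \in edges H -> e \subset codom u ->
       exists2 e', e' \in edges H' & u @: e' \subset e) ->
  poincare k H = poincare k H'.
Proof.
move=> u_inj ukill H'H HH'.
pose x i := if [pick j | u j == i] is Some j then hX k H' j else 0.
have xu j : x (u j) = hX k H' j.
  rewrite /x; case: pickP => [j' /eqP /u_inj -> //|/(_ j)]; by rewrite eqxx.
have x0 i : i \notin codom u -> x i = 0.
  rewrite /x; case: pickP => // j /eqP <-; by rewrite codom_f.
have [|phi [phiC phiX]] := @hg_hom k N N' H H' x.
  move=> e eH; have [eu|/subsetPn[i ie iu]] := boolP (e \subset codom u); last first.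
    by rewrite (bigD1 i) //= x0 // mul0r.
  have [e' e'H' /setIidPr ue'] := HH' e eH eu.
  rewrite (big_setID (u @: e')) /= ue' big_imset /=; last by move=> ? ? _ _ /u_inj.
  by rewrite (eq_bigr _ (fun i _ => xu i)) (hX_edge _ e'H') ?mul0r.
have [|psi [psiC psiX]] := @hg_hom k N' N H' H (fun j => hX k H (u j)).
  move=> e' /H'H[e eH ee'].
  have := hX_edge k eH ee'; rewrite big_imset //= => ? ? _ _; exact: u_inj.
apply: (@poincare_iso _ _ k phi psi).
- apply: (hg_ext (phi := psi \o phi) (psi := idfun)) => [c|i] /=.
    by rewrite phiC psiC.
  rewrite phiX; have [/codomP[j ->]|iu] := boolP (i \in codom u).
    by rewrite xu psiX.
  by rewrite x0 // rmorph0 hX_vertex // ukill.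
- apply: (hg_ext (phi := phi \o psi) (psi := idfun)) => [c|i] /=.
    by rewrite psiC phiC.
  by rewrite psiX phiX xu.
- apply: hg_aug_hom => // i; rewrite phiX /x; case: pickP => [j _|_].
    exact: hg_augX.
  exact: rmorph0.
- exact: hg_aug_onto.
- exact: noetherian_hypergraph.
Qed.

(** The annihilator of the variable v is generated by the monomials of the e :\ v.
    Those with v \in e are variables, as e has size 2. Hence R/(v) and R/(0 : v)
    are obtained by setting variables to zero, and both are retracts. *)
Lemma poincare_vertex_deletion N (H HS HQ : hypergraph N) v :
    [set v] \notin edges H -> (forall e, e \in edges H -> v \in e -> #|e| = 2) ->
    edges HS = [set v] |: edges H -> edges HQ = [set e :\ v | e in edges H] ->
  poincare k H * (poincare k HQ - fpsX * poincare k HS) =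
  poincare k HS * poincare k HQ.
Proof.
move=> vH Hv HSE HQE.
have [|piS [piSC piSX]] := @hg_hom k N N H HS (hX k HS).
  by move=> e eH; apply: hX_edge (subxx _); rewrite HSE !inE eH orbT.
have [|sigS [sigSC sigSX]] :=
    @hg_hom k N N HS H (fun i => if i == v then 0 else hX k H i).
  move=> e; rewrite HSE !inE => /orP[/eqP ->|eH]; first by rewrite big_set1 eqxx.
  have [ve|ve] := boolP (v \in e); first by rewrite (bigD1 v) //= eqxx mul0r.
  rewrite (eq_bigr (hX k H)) ?(hX_edge _ eH) // => i ie.
  by case: eqP => // iv; rewrite -iv ie in ve.
have [|piQ [piQC piQX]] := @hg_hom k N N H HQ (hX k HQ).
  move=> e eH; apply: (@hX_edge _ _ _ (e :\ v)); rewrite ?subD1set // HQE.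
  by apply/imsetP; exists e.
pose xQ i := if (i != v) && ([set v; i] \in edges H) then 0 else hX k H i.
have [|sigQ [sigQC sigQX]] := @hg_hom k N N HQ H xQ.
  move=> _ /[!HQE] /imsetP[e eH ->]; have [ve|ve] := boolP (v \in e).
    have := Hv e eH ve; rewrite (cardsD1 v) ve => -[/eqP/cards1P[i ei]].
    rewrite ei big_set1 /xQ.
    have iv : i != v by have := set11 i; rewrite -ei !inE => /andP[].
    suff -> : [set v; i] = e by rewrite iv eH.
    by rewrite -(setD1K ve) ei.
  have -> : e :\ v = e by apply/setDidPl; rewrite disjoint_sym disjoints1.
  have [/existsP[i /andP[ie /eqP xi]]|/existsPn xn] := boolP [exists i in e, xQ i == 0].
    by rewrite (bigD1 i) //= xi mul0r.
  rewrite (eq_bigr (hX k H)) ?(hX_edge _ eH) // => i ie.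
  by have := xn i; rewrite ie /= /xQ; case: ifP => //; rewrite eqxx.
apply: (@poincare_deletion _ _ _ k (hX k H v) piS sigS piQ sigQ).
- apply: (hg_ext (phi := piS \o sigS) (psi := idfun)) => [c|i] /=.
    by rewrite sigSC piSC.
  rewrite sigSX; case: eqP => [->|_]; last by rewrite piSX.
  by rewrite rmorph0 hX_vertex // HSE !inE eqxx.
- apply: (hg_ext (phi := piQ \o sigQ) (psi := idfun)) => [c|i] /=.
    by rewrite sigQC piQC.
  rewrite sigQX /xQ; case: ifP => [/andP[iv viH]|_]; last by rewrite piQX.
  rewrite rmorph0 hX_vertex // HQE; apply/imsetP; exists [set v; i] => //.
  by rewrite setU1K // inE eq_sym.
- by apply: hg_aug_hom => // i; rewrite piSX hg_augX.
- by apply: hg_aug_hom => // i; rewrite piQX hg_augX.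
- exact: hg_aug_onto.
- exact: hg_augX.
- have v0 : hX k HS v = 0 by apply: hX_vertex; rewrite HSE !inE eqxx.
  move=> a; split=> [pia|[y ->]]; last by rewrite rmorphM piSX v0 mulr0.
  have [||||y] := @hg_endo_mod k N H (sigS \o piS) (hX k H v) _ _ _ _ a.
  + by move=> c; rewrite /= piSC sigSC.
  + by move=> x y; rewrite rmorphD.
  + by move=> x y; rewrite rmorphM.
  + move=> i; rewrite /= piSX sigSX; case: eqP => [->|_].
      by exists 1; rewrite subr0 mulr1.
    by exists 0; rewrite subrr mulr0.
  by rewrite /= pia rmorph0 subr0 => ->; exists y; rewrite mulrC.
- move=> a; have [p <-] := hproj_onto a; rewrite mulrC mulX_eq0.
  have -> : piQ (hproj k H p) = hproj k HQ p.
    elim/mpoly_closed_ind: p => [c|i|p q ep eq|p q ep eq];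
      rewrite ?rmorphD ?rmorphM /= ?ep ?eq //.
    + exact: piQC.
    + exact: piQX.
  rewrite hproj_eq0P.
  have covE m : covered HQ m = covered H (U_(v) + m)%MM.
    rewrite /covered mset_add HQE; apply/existsP/existsP => -[e /andP[]].
      case/imsetP=> e' e'H -> em; exists e'; rewrite e'H /= -subDset.
      exact: em.
    move=> eH em; exists (e :\ v); apply/andP; split; last by rewrite subDset.
    by apply/imsetP; exists e.
  by split=> cov m /cov; rewrite covE.
- exact: noetherian_hypergraph.
- exact: noetherian_hypergraph.
- exact: noetherian_hypergraph.
Qed.

End Operations.

(** * Blowing up vertices *)

Section Substitution.
Variables (k : fieldType) (N : nat) (B : hypergraph N) (x y z : 'I_N).
Hypotheses (xy : x != y) (xz : x != z).
Hypotheses (xB : forall e, e \in edges B -> x \notin e).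
Hypotheses (zB : forall e, e \in edges B -> z \notin e).

Let coveredXZ m : covered B (U_(x) + (U_(z) + m))%MM = covered B m.
Proof.
rewrite /covered; apply: eq_existsb => e; rewrite !mset_add.
have [eB|//] := boolP (e \in edges B); congr (_ && _).
apply/subsetP/subsetP => em i ie; last by rewrite !in_setU1 em ?orbT.
have := em i ie; rewrite !inE => /or3P[/eqP ix|/eqP iz|//].
  by have := xB eB; rewrite -ix ie.
by have := zB eB; rewrite -iz ie.
Qed.

(** The terms of a multiple of y - xz that are of maximal degree in x come from
    the multiplication by xz, which is regular. *)
Lemma subst_regular a : (hX k B y - hX k B x * hX k B z) * a = 0 -> a = 0.
Proof.
have [p <-] := hproj_onto a; rewrite /hX -!rmorphM -rmorphB -rmorphM => /hproj_eq0P cov.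
apply/hproj_eq0P; pose D := \max_(m <- msupp p) m x.
suff H n (m : 'X_{1..N}) : (D - m x < n)%N -> m \in msupp p -> covered B m.
  by move=> m; apply: (H (D - m x).+1).
elim: n m => // n IH m ltn mp; apply: contraT => mcov.
have : (U_(x) + (U_(z) + m))%MM \notin msupp (('X_y - 'X_x * 'X_z) * p).
  by apply/negP => /cov; rewrite coveredXZ (negPf mcov).
rewrite -mcoeff_eq0 mulrBl mcoeffB -mpolyXD addmA.
rewrite [X in _ - X@__]mulrC mcoeffMX subr_eq0 => /eqP eqm.
have : (U_(x) + U_(z) + m)%MM \in msupp ('X_y * p).
  by rewrite mcoeff_msupp eqm -mcoeff_msupp.
rewrite mulrC (perm_mem (msuppMX _ _)) => /mapP[m' m'p mE].
have xm' : m' x = (m x).+1.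
  have := congr1 (fun m : 'X_{1..N} => m x) mE; rewrite /= !mnmDE !mnm1E.
  rewrite eqxx [y == x]eq_sym [z == x]eq_sym (negPf xy) (negPf xz).
  by rewrite !add0n addn0 => <-.
have leD : (m' x <= D)%N by rewrite /D (big_rem m') //= leq_maxl.
have : covered B m' by apply: IH => //; lia.
case/existsP=> e /andP[eB em']; case/negP: mcov; rewrite -coveredXZ addmA mE.
by apply/existsP; exists e; rewrite eB mset_add subsetU // em' orbT.
Qed.

End Substitution.

(** When the vertices v and w lie in the same edges, the series does not change if
    w becomes a free variable. Indeed let B be the algebra where the product of
    v and w is replaced by a new variable y in the generators of the ideal, so
    that v and w are free. Then y - vw and v are regular elements of B, and the
    two algebras in question are B/(y - vw) and, up to the names of the
    variables, B/(v). The edge [set v; w] is excluded since it would turn y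
    into zero. *)
Lemma poincare_twin (k : fieldType) N (H H' : hypergraph N) v w :
    v != w -> (forall e, e \in edges H -> (v \in e) = (w \in e)) ->
    (forall e, e \in edges H -> v \in e -> e != [set v; w]) ->
    edges H' = [set e :\ w | e in edges H] ->
  poincare k H = poincare k H'.
Proof.
move=> vw twin not_pair H'E.
pose u : 'I_N -> 'I_N.+1 := lift ord_max; pose y : 'I_N.+1 := ord_max.
have u_inj : injective u by exact: lift_inj.
have uy i : u i != y by rewrite eq_sym neq_lift.
pose eB (e : {set 'I_N}) : {set 'I_N.+1} :=
  if v \in e then y |: u @: (e :\ v :\ w) else u @: e.
have mem_u i (e : {set 'I_N}) : (u i \in u @: e) = (i \in e) by rewrite mem_imset.
have y_u (e : {set 'I_N}) : y \notin u @: e.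
  by apply/imsetP => -[i _ /eqP]; rewrite eq_sym (negPf (uy i)).
have eB0 : set0 \notin [set eB e | e in edges H].
  apply/imsetP => -[e eH]; rewrite /eB; case: ifP => _ /esym/eqP.
    by rewrite setU_eq0 -subset0 sub1set inE.
  by rewrite imset_eq0 => /eqP e0; have := edges_neq0 H; rewrite -e0 eH.
pose B := Hypergraph eB0.
have BP e : e \in edges B -> exists2 e', e' \in edges H & e = eB e'.
  by case/imsetP=> e' ? ->; exists e'.
have vB e : e \in edges B -> u v \notin e.
  move=> /BP[e' eH ->]; rewrite /eB; case: ifP => [_|/negbT]; last by rewrite mem_u.
  by rewrite !inE negb_or uy mem_u !inE eqxx andbF.
have wB e : e \in edges B -> u w \notin e.
  move=> /BP[e' eH ->]; rewrite /eB; case: ifP => [_|/negbT].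
    by rewrite !inE negb_or uy mem_u !inE eqxx.
  by rewrite mem_u twin.
have prod_u (S : comNzRingType) (F : 'I_N.+1 -> S) (e : {set 'I_N}) :
    \prod_(i in u @: e) F i = \prod_(i in e) F (u i).
  by rewrite big_imset //= => ? ? _ _; exact: u_inj.
pose X i := hX k B (u i).
pose f := hX k B y - X v * X w.
have split_e (S : comNzRingType) (F : 'I_N -> S) (e : {set 'I_N}) :
    e \in edges H -> v \in e ->
    \prod_(i in e) F i = F v * F w * \prod_(i in e :\ v :\ w) F i.
  move=> eH ve; rewrite (big_setD1 v) //= (big_setD1 w) /= ?mulrA //.
  by rewrite !inE eq_sym vw -twin.
have PB : poincare k B = (1 + fpsX) * poincare k H.
  pose x i := if unlift ord_max i is Some j then hX k H j else hX k H v * hX k H w.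
  have xu i : x (u i) = hX k H i by rewrite /x liftK.
  have xy : x y = hX k H v * hX k H w by rewrite /x unlift_none.
  have caseI i : i = y \/ exists j, i = u j.
    by case: (unliftP ord_max i) => [j ->|->]; [right; exists j|left].
  have [|pi [piC piX]] := @hg_hom k _ _ B H x.
    move=> _ /BP[e eH ->]; rewrite /eB; case: ifP => ve; last first.
      by rewrite prod_u (eq_bigr _ (fun i _ => xu i)) (hX_edge _ eH).
    rewrite big_setU1 //= prod_u xy (eq_bigr _ (fun i _ => xu i)) -split_e //.
    exact: hX_edge eH _.
  have yB : [set y] \notin edges B.
    apply/negP => /BP[e eH /setP eE]; have := eE y; rewrite set11 /eB.
    case: ifP => [ve _|_]; last by move/esym; rewrite (negPf (y_u e)).
    have /eqP[] := not_pair e eH ve; apply/setP => i; rewrite !inE.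
    have := eE (u i); rewrite /eB ve !inE (negPf (uy i)) mem_u /= !inE.
    have [->|iv] := eqVneq i v; first by rewrite ve.
    have [->|iw] := eqVneq i w; first by rewrite -twin.
    by rewrite /= => <-.
  have [del [delM delX]] := @hg_del k _ B y yB.
  have pif : pi f = 0 by rewrite rmorphB rmorphM !piX xy !xu subrr.
  (* lifts of polynomials in the variables of H *)
  pose tau : {rmorphism {mpoly k[N]} -> hypergraph_algebra k B} := mmap (hC k B) X.
  have tauX i : tau 'X_i = X i by rewrite /tau /= mmapX mmap1U.
  have tauC c : tau c%:MP = hC k B c by rewrite /tau /= mmapC.
  have tauH q : q \in edge_ideal (k := k) H -> exists r, tau q = f * r.
    case/edge_idealP=> c ->; rewrite rmorph_sum.
    elim/big_rec: _ => [|e r eH [s ->]]; first by exists 0; rewrite mulr0.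
    rewrite rmorphM rmorph_prod (eq_bigr _ (fun i _ => tauX i)) /=.
    have [ve|ve] := boolP (v \in e); last first.
      exists s; have eBE : eB e \in edges B by exact: imset_f.
      have := hX_edge k eBE (subxx _); rewrite /eB (negPf ve) prod_u => ->.
      by rewrite mulr0 add0r.
    have eBE : eB e \in edges B by exact: imset_f.
    have := hX_edge k eBE (subxx _); rewrite /eB ve big_setU1 //= prod_u => e0.
    rewrite split_e //; exists (s - tau (c e) * \prod_(i in e :\ v :\ w) X i).
    set P := \prod_(i in e :\ v :\ w) X i in e0 *.
    rewrite [LHS](_ : _ = f * s - tau (c e) * (f * P - hX k B y * P)).
      by rewrite e0; ring.
    by rewrite /f; ring.
  have lift_pi a : exists q r, a - tau q = f * r /\ pi a = hproj k H q.
    elim/hg_ind: a => [c|i|a b [q [r [ar aq]]] [q' [r' [br bq]]]|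
      a b [q [r [ar aq]]] [q' [r' [br bq]]]].
    - by exists c%:MP, 0; rewrite tauC subrr mulr0 piC.
    - have [->|[j ->]] := caseI i.
        exists ('X_v * 'X_w), 1; rewrite rmorphM !tauX mulr1; split=> //.
        by rewrite piX xy rmorphM.
      by exists 'X_j, 0; rewrite tauX subrr mulr0 piX xu.
    - exists (q + q'), (r + r'); rewrite !rmorphD /= aq bq; split=> //.
      by rewrite opprD addrACA ar br mulrDr.
    - exists (q * q'), (r * b + tau q * r'); rewrite !rmorphM /= aq bq; split=> //.
      rewrite [LHS](_ : _ = (a - tau q) * b + tau q * (b - tau q')); last by ring.
      by rewrite ar br; ring.
  apply: (@poincare_regular_element _ _ k pi _ _ _ _ _ f _ _ del) => //.
  - apply: hg_hom_onto => // i; exists (X i); by rewrite piX xu.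
  - exact: hg_aug_onto.
  - apply: hg_aug_hom => // i; rewrite piX; have [->|[j ->]] := caseI i.
      by rewrite xy rmorphM /= hg_augX mul0r.
    by rewrite xu hg_augX.
  - apply: subst_regular => //; exact: contra_neq (@u_inj _ _) vw.
  - move=> a; split=> [pia|[r ->]]; last by rewrite rmorphM pif mul0r.
    have [q [r [ar aq]]] := lift_pi a.
    have [|s qs] := tauH q; first by rewrite -hproj_eq0 -aq pia.
    by exists (r + s); rewrite mulrDr -ar -qs subrK.
  - by rewrite raddfB /= delM !hg_augX !delX eqxx mulr0 mul0r addr0 subr0.
  - exact: noetherian_hypergraph.
have Bv0 : set0 \notin [set u v] |: edges B.
  by rewrite !inE negb_or edges_neq0 andbT eq_sym -subset0 sub1set inE.
pose Bv := Hypergraph Bv0.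
have PBv : poincare k B = (1 + fpsX) * poincare k Bv.
  exact: (@poincare_free_vertex k _ B Bv (u v)).
have PH' : poincare k Bv = poincare k H'.
  pose g i := if i == v then y else u i.
  have gv : g v = y by rewrite /g eqxx.
  have gu i : i != v -> g i = u i by rewrite /g => /negPf ->.
  have gE e : e \in edges H -> g @: (e :\ w) = eB e.
    move=> eH; rewrite /eB; have [ve|ve] := boolP (v \in e).
      have -> : e :\ v :\ w = e :\ w :\ v by rewrite !setDDl setUC.
      rewrite -{1}(setD1K (_ : v \in e :\ w)) ?inE ?vw // imsetU1 gv.
      by congr (_ |: _); apply: eq_in_imset => i; rewrite !inE => /and3P[/gu].
    have -> : e :\ w = e by apply/setDidPl; rewrite disjoint_sym disjoints1 -twin.
    by apply: eq_in_imset => i ie; rewrite gu //; apply: contraNneq ve => <-.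
  apply: (@poincare_embedding k _ _ Bv H' g).
  - move=> i j; rewrite /g; case: eqP => [->|_]; case: eqP => [->|_] //.
    + by move=> /esym/eqP; rewrite (negPf (uy j)).
    + by move=> /eqP; rewrite (negPf (uy i)).
    + exact: u_inj.
  - move=> i ig; rewrite !inE; apply/orP; left; rewrite (inj_eq set1_inj).
    case: (unliftP ord_max i) ig => [j ->|->] ig; last first.
      by rewrite -[ord_max]gv codom_f in ig.
    rewrite (inj_eq u_inj); apply: contraNT ig => jv.
    by rewrite -[lift _ _]/(u j) -gu // codom_f.
  - move=> _ /[!H'E] /imsetP[e eH ->]; exists (eB e); last by rewrite gE.
    by rewrite !inE imset_f ?orbT.
  - move=> e; rewrite !inE => /orP[/eqP ->|/BP[e' eH ->]].
      move=> /subsetP/(_ (u v)); rewrite set11 => /(_ isT)/codomP[i].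
      rewrite /g; case: eqP => [_ /eqP|iv /u_inj].
        by rewrite (negPf (uy v)).
      by move=> vi; case: iv.
    by exists (e' :\ w); rewrite ?gE // H'E; apply/imsetP; exists e'.
have unit1 : (1 + fpsX : fps rat) \is a GRing.unit.
  by change (is_true ((1 + fpsX : fps rat) 0%N != 0)); rewrite fps_coefD fps_coef1.
by apply: (mulrI unit1); rewrite -PB PBv PH'.
Qed.

Section BlowUp.
Variables (k : fieldType) (N N' : nat) (H : hypergraph N) (H' : hypergraph N').
Variables (c : 'I_N -> 'I_N') (r : 'I_N' -> 'I_N).
Hypothesis rK : cancel r c.
Hypothesis H'_big : forall e, e \in edges H' -> (1 < #|e|)%N.
Hypothesis HE : edges H = [set c @^-1: (e : {set 'I_N'}) | e in edges H'].

(** The edges of H are cut down to U, and the vertices outside U are killed. For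
    U = setT this is H, and for U the set of the representatives r j it is H' up
    to the names of the vertices. *)
Let cut (U : {set 'I_N}) : {set {set 'I_N}} :=
  [set e :&: U | e in edges H] :|: [set [set w] | w in ~: U].

Let cutP U e : reflect ((exists2 e', e' \in edges H' & e = c @^-1: e' :&: U) \/
    (exists2 w, w \notin U & e = [set w])) (e \in cut U).
Proof.
rewrite in_setU; apply: (iffP orP) => -[].
- case/imsetP=> e0; rewrite HE => /imsetP[e' e'H ->] ->; left; by exists e'.
- case/imsetP=> w; rewrite inE => wU ->; right; by exists w.
- case=> e' e'H ->; left; apply/imsetP; exists (c @^-1: e') => //.
  by rewrite HE; apply/imsetP; exists e'.
- by case=> w wU ->; right; apply/imsetP; exists w; rewrite ?inE.
Qed.

Let cut_neq0 (U : {set 'I_N}) : (forall j, r j \in U) -> set0 \notin cut U.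
Proof.
move=> rU; apply/cutP => -[[e' e'H /setP e0]|[w _ /setP/(_ w)]]; last first.
  by rewrite !inE eqxx.
have /set0Pn[j je] : e' != set0 by rewrite -card_gt0 ltnW // H'_big.
by have := e0 (r j); rewrite !inE rK je rU.
Qed.

(** A vertex w of U that is not a representative has the twin r (c w). By
    poincare_twin it may be replaced by a free variable, which contributes the
    factor 1 + t. *)
Let poincare_cut n (U : {set 'I_N}) (G : hypergraph N) :
    (forall j, r j \in U) -> #|U| = (N' + n)%N -> edges G = cut U ->
  poincare k G = (1 + fpsX) ^+ n * poincare k H'.
Proof.
elim: n U G => [|n IH] U G rU cardU GE.
  have UE : U = [set r j | j : 'I_N'].
    apply/esym/eqP; rewrite eqEcard; apply/andP; split.
      by apply/subsetP => _ /imsetP[j _ ->].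
    by rewrite card_imset ?card_ord ?cardU ?addn0 //; exact: can_inj rK.
  have Ucodom i : (i \in codom r) = (i \in U).
    by rewrite UE; apply/codomP/imsetP => [[j ->]|[j _ ->]]; exists j.
  rewrite expr0 mul1r; apply: (@poincare_embedding k _ _ G H' r).
  - exact: can_inj rK.
  - by move=> i; rewrite Ucodom GE => iU; apply/cutP; right; exists i.
  - move=> e' e'H; exists (c @^-1: e' :&: U).
      by rewrite GE; apply/cutP; left; exists e'.
    apply/subsetP => i; rewrite !inE -Ucodom => /andP[ci /codomP[j ij]].
    by rewrite ij imset_f // -(rK j) -ij.
  - move=> e; rewrite GE => /cutP[[e' e'H ->] _|[w wU ->]].
      exists e' => //; apply/subsetP => _ /imsetP[j je ->].
      by rewrite !inE rK je rU.
    by move=> /subsetP/(_ w); rewrite set11 Ucodom (negPf wU) => /(_ isT).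
have [w wU wr] : exists2 w, w \in U & w \notin codom r.
  have : ~~ (U \subset [set r j | j : 'I_N']).
    apply: contraL (leqnn N') => /subset_leq_card; rewrite cardU => le.
    have := leq_trans le (leq_imset_card r _); rewrite card_ord; lia.
  case/subsetPn=> w wU wr; exists w => //.
  by apply: contra wr => /codomP[j ->]; apply/imsetP; exists j.
pose v := r (c w); pose U' := U :\ w.
have rw j : r j != w by apply: contraNneq wr => <-; rewrite codom_f.
have rU' j : r j \in U' by rewrite !inE rw rU.
pose G' := Hypergraph (cut_neq0 rU').
have cutD : [set e :\ w | e in cut U] :|: [set [set w]] = cut U'.
  apply/setP => e; rewrite in_setU in_set1; apply/orP/cutP.
    case=> [/imsetP[_ /cutP[[e' e'H ->]|[w' w'U ->]] ->]|/eqP ->].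
    - by left; exists e'; rewrite // setDE -setIA -setDE.
    - right; exists w'; first by rewrite !inE negb_and w'U orbT.
      apply/setDidPl; rewrite disjoint_sym disjoints1 inE.
      by apply: contraNneq w'U => <-.
    - by right; exists w; rewrite ?setD11.
  case=> [[e' e'H ->]|[w' + ->]].
    left; apply/imsetP; exists (c @^-1: e' :&: U); first by apply/cutP; left; exists e'.
    by rewrite setDE -setIA -setDE.
  rewrite !inE negb_and negbK => /orP[/eqP ->|w'U]; first by right.
  left; apply/imsetP; exists [set w']; first by apply/cutP; right; exists w'.
  apply/esym/setDidPl; rewrite disjoint_sym disjoints1 inE.
  by apply: contraNneq w'U => <-.
have F0 : set0 \notin [set e :\ w | e in edges G].
  apply: contra (cut_neq0 rU'); rewrite -cutD GE inE => ->; exact: isT.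
pose F := Hypergraph F0.
transitivity (poincare k F).
  apply: (@poincare_twin k N G F v w) => //; rewrite ?GE.
  - exact: rw.
  - move=> _ /cutP[[e' e'H ->]|[w' w'U ->]]; first by rewrite !inE rK rU wU.
    rewrite !inE (eq_sym w) [v == w']eq_sym.
    have -> : (w' == w) = false by apply: contraNF w'U => /eqP ->.
    by apply: contraNF w'U => /eqP ->; apply: rU.
  - move=> _ /cutP[[e' e'H ->]|[w' w'U ->]]; last first.
      by rewrite inE => /eqP vw'; rewrite -vw' /v rU in w'U.
    move=> _; apply/eqP => /setP eE.
    have /card_gt1P[i [j [ie je ij]]] := H'_big e'H.
    have [l le lc] : exists2 l, l \in e' & l != c w.
      have [ic|] := eqVneq i (c w); last by exists i.
      by exists j; rewrite // eq_sym -ic.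
    have := eE (r l); rewrite !inE rK le rU (negPf (rw l)) orbF /v.
    by rewrite (can_eq rK) (negPf lc).
rewrite exprS -mulrA -(IH U' G') //; last first.
  by have := cardsD1 w U; rewrite wU cardU /U'; lia.
apply: (@poincare_free_vertex k N F G' w).
  by move=> _ /imsetP[e _ ->]; rewrite !inE eqxx.
by rewrite setUC /= GE cutD.
Qed.

(** The vertices that are not representatives are removed from H one at a time. *)
Theorem poincare_blowup : poincare k H = (1 + fpsX) ^+ (N - N') * poincare k H'.
Proof.
apply: (@poincare_cut _ setT) => [j||]; first by rewrite inE.
  rewrite cardsT card_ord subnKC //.
  by rewrite -[N']card_ord -[N]card_ord; apply: leq_card (can_inj rK).
apply/setP => e; apply/idP/cutP => [|[[e' e'H ->]|[w]]].
- by rewrite HE => /imsetP[e' e'H ->]; left; exists e'; rewrite ?setIT.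
- by rewrite setIT HE; apply/imsetP; exists e'.
- by rewrite inE.
Qed.

End BlowUp.

(** * Graphs *)

Lemma fps_unitE (f : fps rat) : (f \is a GRing.unit) = (f 0%N != 0).
Proof. by []. Qed.

Lemma poincare_of0 (R : comNzRingType) (k : fieldType) (eps : {rmorphism R -> k}) :
    (forall y, exists x, eps x = y) -> noetherian R ->
  poincare_of eps 0%N != 0.
Proof.
move=> eps_onto noeR; have [f [d [c dres]]] := resolution_exists eps noeR.
rewrite (poincare_ofE eps_onto dres) pnatr_eq0 -lt0n hdim_diff subn0 subn_gt0.
rewrite ltn_neqAle rank_leq_col andbT; apply/negP => full.
case: dres (res_complex_aug dres) => -[u uc] _ _ dc.
have c0 : c = 0.
  have /row_fullP[B BE] : row_full (map_mx eps (d 0%N)) by exact: full.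
  by rewrite -[c]mul1mx -BE -mulmxA dc mulmx0.
have := uc; rewrite c0 mulmx0 => /matrixP/(_ 0 0)/eqP.
by rewrite !mxE eq_sym oner_eq0.
Qed.

Section Graphs.
Variable k : fieldType.

Lemma poincare_coef0 N (H : hypergraph N) : poincare k H 0%N != 0.
Proof. exact: poincare_of0 (@hg_aug_onto k N H) (@noetherian_hypergraph k N H). Qed.

Lemma poincare_no_vertex (H : hypergraph 0) : poincare k H = 1.
Proof.
have aug_inj (a : hypergraph_algebra k H) : hg_aug a = 0 -> a = 0.
  have [p <-] := hproj_onto a; rewrite [p]nvar0_mpolyC hg_aug_proj mevalC => ->.
  by rewrite rmorph0.
apply: fpsP => n.
rewrite /poincare (poincare_ofE (@hg_aug_onto k 0 H) (trivial_resolution aug_inj)).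
by rewrite hdim_trivial.
Qed.

Definition induced N N' (H : hypergraph N) (H' : hypergraph N') (u : 'I_N' -> 'I_N) :=
  forall e : {set 'I_N'}, (e \in edges H') = (u @: e \in edges H).

(** The graph H1 is H without v, and H2 is H without v and its neighbours. In the
    quotient by the annihilator of the variable v the neighbours are zero and v
    is free, whence the factor 1 + t of the series of H2. *)
Lemma poincare_graph_deletion N N1 N2 (H : hypergraph N) (H1 : hypergraph N1)
    (H2 : hypergraph N2) (v : 'I_N) (u1 : 'I_N1 -> 'I_N) (u2 : 'I_N2 -> 'I_N) :
    (forall e, e \in edges H -> #|e| = 2) ->
    injective u1 -> induced H H1 u1 -> (forall i, (i \in codom u1) = (i != v)) ->
    injective u2 -> induced H H2 u2 ->
    (forall i, (i \in codom u2) = (i != v) && ([set v; i] \notin edges H)) ->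
  poincare k H * ((1 + fpsX) * poincare k H2 - fpsX * poincare k H1) =
  poincare k H1 * ((1 + fpsX) * poincare k H2).
Proof.
move=> Hcard u1_inj ind1 cod1 u2_inj ind2 cod2.
have vH : [set v] \notin edges H by apply/negP => /Hcard; rewrite cards1.
have HS0 : set0 \notin [set v] |: edges H.
  by rewrite !inE negb_or edges_neq0 andbT eq_sym -subset0 sub1set inE.
pose HS := Hypergraph HS0.
have HQ0 : set0 \notin [set e :\ v | e in edges H].
  apply/imsetP => -[e /Hcard + /esym e0].
  by rewrite (cardsD1 v) e0 cards0; case: (v \in e).
pose HQ := Hypergraph HQ0.
have HQ'0 : set0 \notin [set v] |: edges HQ.
  by rewrite !inE negb_or edges_neq0 andbT eq_sym -subset0 sub1set inE.
pose HQ' := Hypergraph HQ'0.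
have preim M (u : 'I_M -> 'I_N) (e : {set 'I_N}) :
    e \subset codom u -> u @: (u @^-1: e) = e.
  move=> /subsetP eu; apply/setP => i; apply/imsetP/idP => [[j + ->]|ie].
    by rewrite inE.
  by have /codomP[j ij] := eu i ie; exists j; rewrite // inE -ij.
have E1 : poincare k HS = poincare k H1.
  apply: (@poincare_embedding k _ _ HS H1 u1) => //.
  - by move=> i; rewrite cod1 negbK => /eqP ->; rewrite !inE eqxx.
  - by move=> e'; rewrite ind1 => e'H; exists (u1 @: e'); rewrite // !inE e'H orbT.
  - move=> e; rewrite !inE => /orP[/eqP -> /subsetP/(_ v)|eH eu].
      by rewrite set11 cod1 eqxx => /(_ isT).
    by exists (u1 @^-1: e); rewrite ?ind1 preim.
have E2 : poincare k HQ' = poincare k H2.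
  apply: (@poincare_embedding k _ _ HQ' H2 u2) => //.
  - move=> i; rewrite cod2 negb_and !negbK !inE => /orP[/eqP ->|viH].
      by rewrite eqxx.
    apply/orP; right; apply/imsetP; exists [set v; i] => //.
    rewrite setU1K // inE; apply: contraNneq vH => vi.
    by rewrite -vi setUid in viH.
  - move=> e'; rewrite ind2 => e'H; exists (u2 @: e') => //.
    rewrite !inE; apply/orP; right; apply/imsetP; exists (u2 @: e') => //.
    apply/esym/setDidPl; rewrite disjoint_sym disjoints1.
    by apply/imsetP => -[j _ vj]; have := cod2 v; rewrite eqxx vj codom_f.
  - move=> e; rewrite !inE => /orP[/eqP -> /subsetP/(_ v)|].
      by rewrite set11 cod2 eqxx => /(_ isT).
    case/imsetP=> e0 e0H ->; have [ve|ve] := boolP (v \in e0).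
      have := Hcard e0 e0H; rewrite (cardsD1 v) ve => -[/eqP/cards1P[i ei]].
      rewrite ei => /subsetP/(_ i); rewrite set11 cod2 -ei setD1K // e0H andbF.
      by move=> /(_ isT).
    have -> : e0 :\ v = e0 by apply/setDidPl; rewrite disjoint_sym disjoints1.
    by move=> eu; exists (u2 @^-1: e0); rewrite ?ind2 preim.
have EQ : poincare k HQ = (1 + fpsX) * poincare k HQ'.
  apply: (@poincare_free_vertex k N HQ HQ' v) => // _ /imsetP[e _ ->].
  by rewrite !inE eqxx.
rewrite -E1 -E2 -EQ; apply: (@poincare_vertex_deletion k N H HS HQ v) => //.
by move=> e /Hcard.
Qed.

Definition graph_of N (H : hypergraph N) (adj : rel 'I_N) :=
  forall e : {set 'I_N},
    reflect (exists i j, adj i j /\ e = [set i; j]) (e \in edges H).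

Lemma induced_graph N N' (H : hypergraph N) (H' : hypergraph N') adj adj'
    (u : 'I_N' -> 'I_N) :
    graph_of H adj -> graph_of H' adj' -> injective u ->
    (forall i j, adj' i j = adj (u i) (u j)) ->
  induced H H' u.
Proof.
move=> HP HP' u_inj adjE e; apply/HP'/HP => -[i [j [ij eE]]].
  by exists (u i), (u j); rewrite -adjE ij eE imsetU1 imset_set1.
have /imsetP[i' i'e ii'] : i \in u @: e by rewrite eE !inE eqxx.
have /imsetP[j' j'e jj'] : j \in u @: e by rewrite eE !inE eqxx orbT.
exists i', j'; rewrite adjE -ii' -jj'; split=> //.
by apply: (imset_inj u_inj); rewrite eE imsetU1 imset_set1 ii' jj'.
Qed.

Lemma line_graphP n : graph_of (line_graph n) (fun i j => j == i.+1 :> nat).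
Proof.
move=> e; apply: (iffP imsetP) => [[i _ ->]|[i [j [/eqP ij ->]]]].
  exists (inord i), (inord i.+1); split=> //.
  by rewrite !inordK // ?ltnS // ltnW.
have lti : (i < n)%N by have := ltn_ord j; rewrite ij ltnS.
exists (Ordinal lti) => //=; congr [set _; _]; apply/val_inj.
  by rewrite /= inordK.
by rewrite /= inordK ?ltnS.
Qed.

Lemma cycle_graphP n : graph_of (cycle_graph n) (fun i j => j == ordS i).
Proof.
move=> e; apply: (iffP imsetP) => [[i _ ->]|[i [j [/eqP -> ->]]]].
  by exists i, (ordS i).
by exists i.
Qed.

Lemma line_graph_card n e : e \in edges (line_graph n) -> #|e| = 2.
Proof.
move=> /line_graphP[i [j [ij ->]]]; rewrite cards2.
by case: (i =P j) ij => // ->; rewrite eqn_leq ltnn andbF.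
Qed.

Lemma val_ordS n (i : 'I_n) : ordS i = (if i.+1 == n then 0 else i.+1) :> nat.
Proof.
have := ltn_ord i; rewrite /=; case: eqP => [e _|/eqP ne lti]; first by rewrite e modnn.
by rewrite modn_small // ltn_neqAle ne.
Qed.

Lemma cycle_graph_card n e : (2 <= n)%N -> e \in edges (cycle_graph n) -> #|e| = 2.
Proof.
move=> n2 /cycle_graphP[i [j [/eqP -> ->]]]; rewrite cards2.
case: eqP => // /(congr1 (@nat_of_ord n)); rewrite val_ordS.
by case: eqP => [e0 i0|_]; lia.
Qed.

Definition empty_graph : hypergraph 0 := @Hypergraph 0 set0 (negbT (in_set0 set0)).

Lemma ord0_false (i : 'I_0) : False. Proof. by case: i => m; rewrite ltn0. Qed.

Lemma empty_graphP : graph_of empty_graph (fun _ _ => false).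
Proof. by move=> e; rewrite inE; constructor => -[i [j []]]. Qed.

Lemma line_induced m n (u : 'I_m.+1 -> 'I_n.+1) a :
  (forall i, u i = (a + i)%N :> nat) -> induced (line_graph n) (line_graph m) u.
Proof.
move=> uE; apply: (induced_graph (@line_graphP n) (@line_graphP m)).
  by move=> i j /(congr1 (@nat_of_ord _)); rewrite !uE => /addnI/val_inj.
by move=> i j; rewrite !uE -addnS eqn_add2l.
Qed.

Lemma shift_inj m n (u : 'I_m -> 'I_n) a :
  (forall i, u i = (a + i)%N :> nat) -> injective u.
Proof. by move=> uE i j /(congr1 (@nat_of_ord _)); rewrite !uE => /addnI/val_inj. Qed.

Lemma shift_codom m n (u : 'I_m -> 'I_n) a :
  (forall i, u i = (a + i)%N :> nat) -> forall j, (j \in codom u) = (a <= j < a + m)%N.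
Proof.
move=> uE j; apply/codomP/idP => [[i ->]|/andP[aj jm]].
  by rewrite uE leq_addr ltn_add2l ltn_ord.
have ltm : (j - a < m)%N by lia.
by exists (Ordinal ltm); apply/val_inj; rewrite /= uE /= subnKC.
Qed.

Lemma poincare_line0 : poincare k (line_graph 0) = 1 + fpsX.
Proof.
have edge0 e : e \in edges (line_graph 0) = false.
  by apply/negP => /line_graphP[i [j [+ _]]]; rewrite !ord1.
have K0 : set0 \notin [set ord0] |: edges (line_graph 0).
  by rewrite !inE negb_or edges_neq0 andbT eq_sym -subset0 sub1set inE.
rewrite (@poincare_free_vertex k 1 (line_graph 0) (Hypergraph K0) ord0) //; last first.
  by move=> e; rewrite edge0.
rewrite (@poincare_embedding k 1 0 _ empty_graph (fun i => widen_ord (leq0n 1) i)).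
- by rewrite poincare_no_vertex mulr1.
- by move=> i; case: (ord0_false i).
- by move=> i _; rewrite !inE ord1 eqxx.
- by move=> e; rewrite inE.
- move=> e; rewrite in_setU in_set1 edge0 orbF => /eqP -> /subsetP/(_ ord0).
  by rewrite set11 => /(_ isT)/codomP[i]; case: (ord0_false i).
Qed.

Lemma mul_unit_eq (a b c : fps rat) : b 0%N != 0 -> a * b = c -> a = c / b.
Proof. by move=> b0 <-; rewrite mulrK // fps_unitE. Qed.

Lemma line_adjacent n (i j : 'I_n.+1) : ([set i; j] \in edges (line_graph n)) =
  (j == i.+1 :> nat) || (i == j.+1 :> nat).
Proof.
apply/idP/orP => [ije|[ij|ji]]; last 2 first.
- by apply/line_graphP; exists i, j.
- by apply/line_graphP; exists j, i; rewrite setUC.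
have := line_graph_card ije; rewrite cards2; case: eqP => // ij _.
have /line_graphP[a [b [ab /setP E]]] := ije.
have := E i; have := E j; rewrite !inE !eqxx !orbT /=.
case/esym/orP=> /eqP ja /esym/orP[]/eqP ia.
- by case: ij; rewrite ia ja.
- by right; rewrite ja ia.
- by left; rewrite ja ia.
- by case: ij; rewrite ia ja.
Qed.

Lemma poincare_line1 : poincare k (line_graph 1) = (1 + fpsX) / (1 - fpsX).
Proof.
have wE (i : 'I_1) : widen_ord (leqnSn 1) i = (0 + i)%N :> nat by [].
have := @poincare_graph_deletion 2 1 0 (line_graph 1) (line_graph 0) empty_graph
  ord_max (widen_ord (leqnSn 1)) (widen_ord (leq0n 2)).
rewrite poincare_no_vertex poincare_line0 mulr1 => E.
have unit1X : (1 + fpsX : fps rat) \is a GRing.unit by [].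
apply: mul_unit_eq; first by [].
apply: (mulIr unit1X); rewrite -mulrA.
have -> : (1 - fpsX) * (1 + fpsX) = 1 + fpsX - fpsX * (1 + fpsX) :> fps rat by ring.
apply: E.
- exact: line_graph_card.
- exact: shift_inj wE.
- exact: line_induced wE.
- by move=> i; rewrite (shift_codom wE) -val_eqE /=; have := ltn_ord i; lia.
- by move=> i; case: (ord0_false i).
- by apply: (induced_graph (@line_graphP 1) empty_graphP) => i; case: (ord0_false i).
- move=> i; rewrite line_adjacent /=; apply/codomP/idP => [[j]|].
    by case: (ord0_false j).
  by case: i => [[|[|]]].
Qed.

(** The last vertex is deleted; it has a single neighbour. *)
Lemma poincare_line n : (2 <= n)%N ->
  poincare k (line_graph n) =
  (1 + fpsX) * poincare k (line_graph (n - 1)) * poincare k (line_graph (n - 2)) /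
  ((1 + fpsX) * poincare k (line_graph (n - 2)) -
   fpsX * poincare k (line_graph (n - 1))).
Proof.
case: n => [//|[//|n]] _; rewrite !subSS !subn0.
have w1 (i : 'I_n.+2) : widen_ord (leqnSn n.+2) i = (0 + i)%N :> nat by [].
have le2 : (n.+1 <= n.+3)%N by lia.
have w2 (i : 'I_n.+1) : widen_ord le2 i = (0 + i)%N :> nat by [].
apply: mul_unit_eq.
  rewrite fps_coefB !fps_coefM0 fps_coefD mul0r subr0 addr0 mul1r; exact: poincare_coef0.
rewrite (@poincare_graph_deletion _ _ _ (line_graph n.+2) (line_graph n.+1)
  (line_graph n) ord_max (widen_ord (leqnSn n.+2)) (widen_ord le2)).
- by ring.
- exact: line_graph_card.
- exact: shift_inj w1.
- exact: line_induced w1.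
- by move=> i; rewrite (shift_codom w1) -val_eqE /=; have := ltn_ord i; lia.
- exact: shift_inj w2.
- exact: line_induced w2.
- move=> i; rewrite (shift_codom w2) line_adjacent -val_eqE /=; have := ltn_ord i; lia.
Qed.

Lemma cycle_adjacent n (i j : 'I_n) : (2 <= n)%N ->
  ([set i; j] \in edges (cycle_graph n)) = (j == ordS i) || (i == ordS j).
Proof.
move=> n2; apply/idP/orP => [ije|[/eqP ->|/eqP ->]]; last 2 first.
- by apply/cycle_graphP; exists i, (ordS i).
- by apply/cycle_graphP; exists j, (ordS j); rewrite setUC.
have := cycle_graph_card n2 ije; rewrite cards2; case: eqP => // ij _.
have /cycle_graphP[a [b [ab /setP E]]] := ije.
have := E i; have := E j; rewrite !inE !eqxx !orbT /=.
case/esym/orP=> /eqP ja /esym/orP[]/eqP ia.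
- by case: ij; rewrite ia ja.
- by right; rewrite ja ia.
- by left; rewrite ja ia.
- by case: ij; rewrite ia ja.
Qed.

(** The last vertex is deleted. Removing its two neighbours as well leaves the line
    on the vertices 1, ..., n - 3, which u2 numbers from 0. *)
Lemma poincare_cycle n : (4 <= n)%N ->
  poincare k (cycle_graph n) =
  (1 + fpsX) * poincare k (line_graph (n - 2)) * poincare k (line_graph (n - 4)) /
  (- fpsX * poincare k (line_graph (n - 2)) +
   (1 + fpsX) * poincare k (line_graph (n - 4))).
Proof.
case: n => [//|[//|[//|[//|n]]]] _; rewrite !subSS !subn0.
have w1 (i : 'I_n.+3) : widen_ord (leqnSn n.+3) i = (0 + i)%N :> nat by [].
have lt2 (i : 'I_n.+1) : (1 + i < n.+4)%N by have := ltn_ord i; lia.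
pose u2 (i : 'I_n.+1) : 'I_n.+4 := Ordinal (lt2 i).
have w2 (i : 'I_n.+1) : u2 i = (1 + i)%N :> nat by [].
have ind m (u : 'I_m.+1 -> 'I_n.+4) a : (forall i, u i = (a + i)%N :> nat) ->
    (a + m < n.+3)%N -> induced (cycle_graph n.+4) (line_graph m) u.
  move=> uE am; apply: (induced_graph (@cycle_graphP _) (@line_graphP _)).
    exact: shift_inj uE.
  move=> i j; rewrite -val_eqE /= -/(nat_of_ord (ordS (u i))).
  rewrite -[val (u j)]/(nat_of_ord (u j)).
  rewrite -[(_ %% _)%N]/(nat_of_ord (ordS (u i))) val_ordS !uE.
  by have := ltn_ord i; case: ((a + i).+1 =P n.+4); lia.
apply: mul_unit_eq.
  rewrite fps_coefD !fps_coefM0 fps_coefD fps_coefN oppr0 mul0r add0r addr0 mul1r.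
  exact: poincare_coef0.
rewrite mulNr addrC (@poincare_graph_deletion _ _ _ (cycle_graph n.+4)
  (line_graph n.+2) (line_graph n) ord_max (widen_ord (leqnSn n.+3)) u2).
- by ring.
- by move=> e; apply: cycle_graph_card.
- exact: shift_inj w1.
- by apply: (ind _ _ 0%N w1); lia.
- by move=> i; rewrite (shift_codom w1) -val_eqE /=; have := ltn_ord i; lia.
- exact: shift_inj w2.
- by apply: (ind _ _ 1%N w2); lia.
- move=> i; rewrite (shift_codom w2) cycle_adjacent // -!val_eqE.
  rewrite -[val (ordS _)]/(nat_of_ord (ordS _)).
  rewrite -[val (ordS i)]/(nat_of_ord (ordS i)) !val_ordS /=.
  have := ltn_ord i; rewrite eqxx; case: (i.+1 =P n.+4); lia.
Qed.

End Graphs.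

(** * Hyperlines and hypercycles as blow-ups *)

Lemma poincare_blowup_edges (k : fieldType) n N N'
    (H : hypergraph N) (H' : hypergraph N')
    (e : 'I_n -> {set 'I_N}) (e' : 'I_n -> {set 'I_N'}) (c : 'I_N -> 'I_N') :
    edges H = [set e i | i : 'I_n] -> edges H' = [set e' i | i : 'I_n] ->
    (forall e, e \in edges H' -> #|e| = 2) ->
    (forall v i, (v \in e i) = (c v \in e' i)) -> (forall j, exists v, c v = j) ->
  poincare k H = (1 + fpsX) ^+ (N - N') * poincare k H'.
Proof.
move=> HE H'E H'card ce csurj.
have /fin_all_exists[r rK] := csurj.
apply: (@poincare_blowup k N N' H H' c r) => [//|f /H'card -> //|].
have eE i : e i = c @^-1: e' i by apply/setP => v; rewrite inE ce.
apply/setP => f; rewrite HE H'E.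
apply/imsetP/imsetP => [[i _ ->]|[_ /imsetP[i _ ->] ->]].
  by exists (e' i); rewrite ?imset_f.
by exists i.
Qed.

Lemma eq_sum_pointwise (I : finType) (F G : I -> nat) :
  (forall i, F i <= G i)%N -> (\sum_i F i = \sum_i G i)%N -> forall i, F i = G i.
Proof.
move=> FG sumFG i.
have /leqif_sum : forall i, true -> (F i <= G i ?= iff (F i == G i))%N.
  by move=> j _; apply: leqif_eq.
by case=> _; rewrite sumFG eqxx => /esym/forallP/(_ i)/eqP.
Qed.

Section Degrees.
Variables (n N : nat) (e : 'I_n -> {set 'I_N}).

Definition degree v := #|[set i | v \in e i]|.

Lemma degreeE v : degree v = (\sum_i (v \in e i))%N.
Proof. by rewrite /degree -sum1dep_card big_mkcond. Qed.

Lemma sum_degree : (\sum_v degree v = \sum_i #|e i|)%N.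
Proof.
under eq_bigr => v _ do rewrite degreeE.
rewrite exchange_big; apply: eq_bigr => i _.
by rewrite -sum1_card [RHS]big_mkcond.
Qed.

Lemma sum_degree2 : (\sum_v degree v ^ 2 = \sum_i \sum_j #|e i :&: e j|)%N.
Proof.
under eq_bigr => v _ do rewrite degreeE -mulnn big_distrlr.
rewrite exchange_big; apply: eq_bigr => i _.
rewrite exchange_big; apply: eq_bigr => j _ /=.
rewrite -sum1_card [RHS]big_mkcond; apply: eq_bigr => v _.
by rewrite inE mulnb; case: (_ && _).
Qed.

End Degrees.

Lemma sum_eq1 n (x : 'I_n) a : (\sum_(j < n) (j == x) * a = a)%N.
Proof.
rewrite (bigD1 x) //= eqxx mul1n big1 ?addn0 // => j /negPf ->.
by rewrite mul0n.
Qed.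

Lemma sum_succ n a : (\sum_(i < n) \sum_(j < n) (j == i.+1 :> nat) * a = n.-1 * a)%N.
Proof.
have inner (i : 'I_n) : (\sum_(j < n) (j == i.+1 :> nat) * a = (i.+1 < n) * a)%N.
  have [lti|gei] := ltnP i.+1 n; first by rewrite mul1n -[RHS](sum_eq1 (Ordinal lti)).
  by rewrite big1 // => j _; have := ltn_ord j; case: eqP => // ->; rewrite ltnNge gei.
under eq_bigr => i _ do rewrite inner.
case: n inner => [|n] _; first by rewrite big_ord0.
rewrite big_ord_recr /= ltnn mul0n addn0 (eq_bigr (fun=> a)).
  by rewrite sum_nat_const card_ord.
by move=> i _; rewrite ltnS ltn_ord mul1n.
Qed.

Lemma ordS_inj n : injective (@ordS n).
Proof. exact: can_inj (@ordSK n). Qed.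

Lemma ordS_neq n (i : 'I_n) : (3 <= n)%N -> ordS i != i /\ ordS (ordS i) != i.
Proof.
move=> n3; rewrite -!val_eqE -[val (ordS i)]/(nat_of_ord (ordS i)).
rewrite -[val (ordS (ordS i))]/(nat_of_ord (ordS (ordS i))) !val_ordS /=.
have := ltn_ord i; case: (i.+1 =P n) => ?; [case: (1%N =P n)|case: (i.+2 =P n)]; lia.
Qed.

(** The number of vertices and the sizes of the edges and of their intersections
    determine the first two moments of the degrees of the vertices; they force
    all degrees to be 2. A vertex thus lies in two consecutive edges, and the
    second of them is the vertex of the cycle that it is sent to. *)
Lemma hypercycle_blocks n a N (e : 'I_n -> {set 'I_N}) :
    (3 <= n)%N -> (1 <= a)%N -> N = (n * a)%N ->
    (forall i, #|e i| = (2 * a)%N) ->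
    (forall i j, i != j ->
       #|e i :&: e j| = if (j == ordS i) || (i == ordS j) then a else 0%N) ->
  exists c : 'I_N -> 'I_n, (forall v i, (v \in e i) = (c v \in [set i; ordS i])) /\
    forall j, exists v, c v = j.
Proof.
move=> n3 a1 NE card_e card_ee.
have meet i j : #|e i :&: e j| =
    ((j == i) * (2 * a) + (j == ordS i) * a + (i == ordS j) * a)%N.
  have [S1 S2] := ordS_neq i n3.
  have [->|ij] := eqVneq j i; first by rewrite setIid card_e eq_sym (negPf S1); lia.
  rewrite card_ee 1?eq_sym //; have [->|] := eqVneq j (ordS i).
    by rewrite (eq_sym i) (negPf S2) /=; lia.
  by case: (i == ordS j); rewrite /=; lia.
(* the sum of (deg v - 2)^2 vanishes *)
have deg2 v : degree e v = 2%N.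
  have : (4 * degree e v = degree e v ^ 2 + 4)%N.
    apply: (@eq_sum_pointwise _ (fun v => 4 * degree e v)%N
      (fun v => degree e v ^ 2 + 4)%N) => {v}[v|].
      by rewrite -mulnn; case: (degree e v) => [|[|d]]; nia.
    have -> : (\sum_v 4 * degree e v = 4 * \sum_v degree e v)%N by rewrite big_distrr.
    rewrite big_split /= sum_degree sum_degree2.
    rewrite sum_nat_const card_ord (eq_bigr (fun=> 2 * a)%N) // sum_nat_const card_ord.
    have -> : (\sum_i \sum_j #|e i :&: e j| = n * (2 * a) + n * a + n * a)%N.
      under eq_bigr => i _ do (under eq_bigr => j _ do rewrite meet).
      under eq_bigr => i _ do rewrite !big_split /= !sum_eq1.
      rewrite !big_split /= !sum_nat_const !card_ord; congr (_ + _)%N; first by lia.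
      rewrite exchange_big /= (eq_bigr (fun=> a)) ?sum_nat_const ?card_ord // => j _.
      exact: sum_eq1.
    by rewrite NE; lia.
  by rewrite -mulnn; case: (degree e v) => [|[|[|d]]]; nia.
have pos v : exists i, forall j, (v \in e j) = (j == i) || (j == ordS i).
  have /eqP/cards2P[i [j [ij /setP ijE]]] : #|[set l | v \in e l]| = 2 := deg2 v.
  have vE l : (v \in e l) = (l == i) || (l == j) by have := ijE l; rewrite !inE.
  have : v \in e i :&: e j by rewrite inE !vE !eqxx orbT.
  move=> vij; have : (0 < #|e i :&: e j|)%N by apply/card_gt0P; exists v.
  rewrite card_ee //; case: ifP => // /orP[]/eqP ? _; subst.
    by exists i.
  by exists j => l; rewrite vE orbC.
have /fin_all_exists[p pE] := pos.
exists (fun v => ordS (p v)); split=> [v i|j].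
  by rewrite pE !inE (inj_eq (@ordS_inj n)) orbC eq_sym [p v == i]eq_sym.
have : (0 < #|e (ord_pred j) :&: e (ordS (ord_pred j))|)%N.
  have [S1 _] := ordS_neq (ord_pred j) n3.
  by rewrite card_ee ?eqxx // eq_sym.
case/card_gt0P=> v; rewrite inE ord_predK !pE => /andP[+ jv].
have [S1 S2] := ordS_neq (p v) n3.
case/orP=> /eqP jp; exists v; first by rewrite -jp ord_predK.
have jE : j = ordS (ordS (p v)) by rewrite -jp ord_predK.
by move: jv; rewrite jE (negPf S2) (inj_eq (@ordS_inj n)) (negPf S1).
Qed.

(** Here the moments force the degrees to be 1 or 2. A vertex of degree 2 lies in
    two consecutive edges and is sent to the vertex of the line between them;
    one of degree 1 lies in the first or in the last edge. *)
Lemma hyperline_blocks n a N (e : 'I_n -> {set 'I_N}) :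
    (1 <= n)%N -> (1 <= a)%N -> N = (n.+1 * a)%N ->
    (forall i, #|e i| = (2 * a)%N) ->
    (forall i j, i != j ->
       #|e i :&: e j| = if (j == i.+1 :> nat) || (i == j.+1 :> nat) then a else 0%N) ->
  exists c : 'I_N -> 'I_n.+1,
    (forall v i, (v \in e i) = (c v == i :> nat) || (c v == i.+1 :> nat)) /\
    forall j, exists v, c v = j.
Proof.
move=> n1 a1 NE card_e card_ee.
have meet i j : #|e i :&: e j| =
    ((j == i) * (2 * a) + (j == i.+1 :> nat) * a + (i == j.+1 :> nat) * a)%N.
  have [->|ij] := eqVneq j i; first by rewrite setIid card_e; case: eqP; lia.
  rewrite card_ee 1?eq_sym //=; case: eqP; case: eqP; rewrite /=; lia.
(* the sum of (deg v - 1)(deg v - 2) vanishes *)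
have deg12 v : degree e v = 1%N \/ degree e v = 2%N.
  have : (3 * degree e v = degree e v ^ 2 + 2)%N.
    apply: (@eq_sum_pointwise _ (fun v => 3 * degree e v)%N
      (fun v => degree e v ^ 2 + 2)%N) => {v}[v|].
      by rewrite -mulnn; case: (degree e v) => [|[|d]]; nia.
    have -> : (\sum_v 3 * degree e v = 3 * \sum_v degree e v)%N by rewrite big_distrr.
    rewrite big_split /= sum_degree sum_degree2.
    rewrite sum_nat_const card_ord (eq_bigr (fun=> 2 * a)%N) // sum_nat_const card_ord.
    have -> : (\sum_i \sum_j #|e i :&: e j| = n * (2 * a) + n.-1 * a + n.-1 * a)%N.
      under eq_bigr => i _ do (under eq_bigr => j _ do rewrite meet).
      under eq_bigr => i _ do rewrite !big_split /= !sum_eq1.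
      rewrite !big_split /= !sum_nat_const !card_ord sum_succ.
      congr (_ + _)%N; first by lia.
      by rewrite exchange_big sum_succ.
    by rewrite NE; case: (n) n1 => [//|m] _ /=; nia.
  by rewrite -mulnn; case: (degree e v) => [|[|[|d]]]; nia.
have block v : (1 < n)%N -> exists c : 'I_n.+1,
    forall i, (v \in e i) = (c == i :> nat) || (c == i.+1 :> nat).
  move=> n2; have [/eqP/cards1P[i /setP iE]|/eqP/cards2P[i [j [ij /setP ijE]]]] :
      #|[set l | v \in e l]| = 1%N \/ #|[set l | v \in e l]| = 2%N := deg12 v.
    have vE l : (v \in e l) = (l == i) by have := iE l; rewrite !inE.
    have vi : v \in e i by rewrite vE.
    have [i0|i_gt0] := posnP i.
      exists ord0 => l; rewrite vE -val_eqE /= i0; lia.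
    have [iN|i_lt] : i.+1 = n \/ (i.+1 < n)%N by have := ltn_ord i; lia.
      exists ord_max => l; rewrite vE -val_eqE /=; have := ltn_ord l; lia.
    (* an inner edge is covered by its two neighbours *)
    have lt' : (i.-1 < n)%N by lia.
    pose p := Ordinal lt'; pose q := Ordinal i_lt.
    have pi : p != i by rewrite -val_eqE /=; lia.
    have qi : q != i by rewrite -val_eqE /=; lia.
    have pq : p != q by rewrite -val_eqE /=; lia.
    have cp : #|e i :&: e p| = a by rewrite card_ee 1?eq_sym //= prednK // eqxx orbT.
    have cq : #|e i :&: e q| = a by rewrite card_ee 1?eq_sym //= eqxx.
    have pq0 : e p :&: e q = set0.
      apply/eqP; rewrite -cards_eq0 card_ee //=; case: ifP => //; lia.
    have cover : (e i :&: e p) :|: (e i :&: e q) = e i.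
      apply/eqP; rewrite eqEcard subUset !subsetIl cardsU cp cq.
      by rewrite setIACA setIid pq0 setI0 cards0 card_e; lia.
    have := vi; rewrite -cover !inE !vE.
    by rewrite (negPf pi) (negPf qi) !andbF.
  have vE l : (v \in e l) = (l == i) || (l == j) by have := ijE l; rewrite !inE.
  have : v \in e i :&: e j by rewrite inE !vE !eqxx orbT.
  move=> vij; have : (0 < #|e i :&: e j|)%N by apply/card_gt0P; exists v.
  rewrite card_ee //; case: ifP => // /orP[]/eqP ji _.
    have lti : (i.+1 < n.+1)%N by have := ltn_ord i; lia.
    by exists (Ordinal lti) => l; rewrite vE -!val_eqE /= ji; lia.
  have ltj : (j.+1 < n.+1)%N by have := ltn_ord j; lia.
  by exists (Ordinal ltj) => l; rewrite vE -!val_eqE /= ji; lia.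
have [n2|n_le1] := ltnP 1 n.
  have /fin_all_exists[c cE] := fun v => block v n2.
  exists c; split=> // j.
  have uniq v : (forall i : 'I_n, (v \in e i) = (j == i :> nat) || (j == i.+1 :> nat)) ->
      exists v, c v = j.
    move=> jE; exists v; apply/val_inj => /=.
    have eqn i (lti : (i < n)%N) : (c v == i :> nat) || (c v == i.+1 :> nat) =
        (j == i :> nat) || (j == i.+1 :> nat).
      by have := cE v (Ordinal lti); rewrite jE.
    have ltj := ltn_ord j; have ltc := ltn_ord (c v).
    have E1 := eqn (c v); have E2 := eqn (c v).-1.
    have E3 := eqn j; have E4 := eqn j.-1; lia.
  have n1' : (n.-1 < n)%N by lia.
  have [j0|j_gt0] := posnP j.
    pose i0 : 'I_n := Ordinal n1; pose i1 : 'I_n := Ordinal n2.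
    have /card_gt0P[v] : (0 < #|e i0 :\: e i1|)%N.
      by rewrite cardsD card_e card_ee //= subn_gt0; lia.
    rewrite !inE => /andP[v1 v0]; apply: (uniq v) => i.
    move: v0 v1; rewrite !cE /= j0; lia.
  have [jn|jn] : (j = n :> nat) \/ (j < n)%N by have := ltn_ord j; lia.
    have n2' : (n.-2 < n)%N by lia.
    pose i0 : 'I_n := Ordinal n1'; pose i1 : 'I_n := Ordinal n2'.
    have /card_gt0P[v] : (0 < #|e i0 :\: e i1|)%N.
      rewrite cardsD card_e card_ee ?subn_gt0; first by case: ifP; lia.
      by rewrite -val_eqE /=; lia.
    rewrite !inE => /andP[v1 v0]; apply: (uniq v) => i.
    by move: v0 v1; rewrite !cE /= jn; have := ltn_ord i; lia.
  have jp : (j.-1 < n)%N by lia.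
  have /card_gt0P[v] : (0 < #|e (Ordinal jp) :&: e (Ordinal jn)|)%N.
    by rewrite card_ee ?prednK ?eqxx // -val_eqE /=; lia.
  rewrite !inE => /andP[v1 v0]; apply: (uniq v) => i.
  by move: v0 v1; rewrite !cE /=; lia.
(* a single edge: its vertices are split arbitrarily *)
have {n_le1}n_eq1 : n = 1%N by lia.
subst n; have N2 : (1 < N)%N by rewrite NE; lia.
have eT i : e i = setT.
  by apply/eqP; rewrite eqEcard subsetT cardsT card_ord card_e NE leqnn.
exists (fun v => if v == 0 :> nat then ord0 else ord_max); split=> [v i|j].
  by rewrite eT inE ord1; case: ifP.
case: (unliftP ord0 j) => [j' ->|->].
  by exists (Ordinal N2); rewrite /= ord1; apply/val_inj.
by exists (Ordinal (ltnW N2)).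
Qed.

(* In the formula for PC, the summand PL (n - 2) of the denominator carries the
   factor - t, as it does in the formula for PL.  Without it the right-hand
   side would have constant term 1/2, whereas PC n has constant term 1. *)
Theorem theorem2p1 (k : fieldType) :
  let t : fps rat := fpsX in
  let PL (n : nat) : fps rat := poincare k (line_graph n) in
  let PC (n : nat) : fps rat := poincare k (cycle_graph n) in
  [/\ PL 0%N = 1 + t /\ PL 1%N = (1 + t) / (1 - t),
      forall n : nat, (2 <= n)%N ->
        PL n = ((1 + t) * PL (n - 1)%N * PL (n - 2)%N)
               / ((1 + t) * PL (n - 2)%N - t * PL (n - 1)%N),
      forall n : nat, (4 <= n)%N ->
        PC n = ((1 + t) * PL (n - 2)%N * PL (n - 4)%N)
               / (- t * PL (n - 2)%N + (1 + t) * PL (n - 4)%N),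
      forall (n a N : nat) (H : hypergraph N), (1 <= n)%N -> (1 <= a)%N ->
        is_hyperline n (2 * a) a H ->
        poincare k H = (1 + t) ^+ ((n + 1) * (a - 1)) * PL n &
      forall (n a N : nat) (H : hypergraph N), (3 <= n)%N -> (1 <= a)%N ->
        is_hypercycle n (2 * a) a H ->
        poincare k H = (1 + t) ^+ (n * (a - 1)) * PC n].
Proof.
move=> t PL PC; split.
- by split; [exact: poincare_line0|exact: poincare_line1].
- exact: poincare_line.
- exact: poincare_cycle.
- move=> n a N H n1 a1 [NE [e [_ HE card_e card_ee]]].
  have NE' : N = (n.+1 * a)%N by rewrite NE; nia.
  have [c [ce csurj]] := hyperline_blocks n1 a1 NE' card_e card_ee.
  have -> : ((n + 1) * (a - 1) = N - n.+1)%N by rewrite NE' mulnBr muln1 addn1.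
  rewrite /PL /t.
  apply: (@poincare_blowup_edges k n N n.+1 H (line_graph n) e
    (fun i => [set inord i; inord i.+1]) c) => //; first exact: line_graph_card.
  move=> v i.
  rewrite ce !inE -!val_eqE /= !inordK //; have := ltn_ord i; lia.
- move=> n a N H n3 a1 [NE [e [_ HE _ card_e card_ee]]].
  have NE' : N = (n * a)%N by rewrite NE; nia.
  have [c [ce csurj]] := hypercycle_blocks n3 a1 NE' card_e card_ee.
  have -> : (n * (a - 1) = N - n)%N by rewrite NE' mulnBr muln1.
  rewrite /PC /t.
  apply: (@poincare_blowup_edges k n N n H (cycle_graph n) e
    (fun i => [set i; ordS i]) c) => // f.
  by apply: cycle_graph_card; lia.
Qed.
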